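(* Let $\Gamma$ be a finitely generated amenable group and let $\mathcal C\in\mathcal A^\Gamma$ be a coloring of $\Gamma$ by a finite set $\mathcal A$. Suppose that $\mathcal C$ is symbolically tempered repetitive with respect to some strong Følner exhaustion sequence $(T_m)$ in $\Gamma$. Then for every self-adjoint operator $H:\ell^2(\Gamma)\to\ell^2(\Gamma)$ which has finite hopping range and is $\mathcal C$-invariant there is a right-continuous function $N_H:\mathbb R\to[0,1]$ (the integrated density of states of $H$) such that $$\lim_{m\to\infty}\big\|N_H-N_{H_m}\big\|_\infty=0,$$ where $N_{H_m}$ is the empirical eigenvalue distribution function of the restriction $H_m$ of $H$ to the subspace $\ell^2\big((T_m^{-1})^R\big)$ of $\ell^2(T_m^{-1})$, $R$ being the overall range of $H$.
   Context: $\Gamma$ is a group with identity $e$ generated by a finite symmetric set $S$; $m_\Gamma$ is counting measure; $d_S(g,h)$ is the word metric (the minimal $L$ with $g^{-1}h$ a product of $L$ elements of $S$), and $B_n(g)=\{h\in\Gamma:d_S(g,h)<n\}$. Repetitivity. For finite $F\subseteq\Gamma$ the $F$-patch of $\mathcal C$ is $\mathcal C|_F$. Patches on $F$ and $F'$ are equivalent if there is $\gamma\in\Gamma$ with $\gamma F=F'$ and $\mathcal C(\gamma s)=\mathcal C(s)$ for all $s\in F$; equivalence classes are patterns, and $[F]_{\mathcal C}$ is the set of patterns of all patches $\mathcal C|_{\gamma F}$, $\gamma\in\Gamma$. A pattern $p\in[F]_{\mathcal C}$ occurs in a finite set $T$ if there are a representative $\mathcal C|_{xF}$ of $p$ and $\gamma\in\Gamma$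 with $\gamma xF\subseteq T$ and $\mathcal C(\gamma xs)=\mathcal C(xs)$ for all $s\in F$. A strong Følner exhaustion sequence in the discrete group $\Gamma$ is a sequence $\mathcal T=(T_m)_{m\in\mathbb N}$ of finite sets with $e\in T_m\subseteq T_{m+1}$, $\bigcup_mT_m=\Gamma$, $m_\Gamma(T_m\triangle KT_m)/m_\Gamma(T_m)\to0$ for every nonempty finite $K$ and $m_\Gamma(\partial_K(T_m))/m_\Gamma(T_m)\to0$ for every finite $K$, where $\partial_K(T)=\{g:Kg\cap T\neq\emptyset\text{ and }Kg\cap(\Gamma\setminus T)\ne\emptyset\}$. Let $\mathcal R^{\mathcal T}_{\mathcal C}(m)\in\mathbb N\cup\{\infty\}$ be the infimum of all $n$ such that every $p\in[T_m^{-1}]_{\mathcal C}$ occurs in $\gamma T_n^{-1}$ for all $\gamma\in\Gamma$. $\mathcal C$ is symbolically tempered repetitive with respect to $\mathcal T$ if $\inf_m m_\Gamma(T_m)/m_\Gamma(T_{\mathcal R^{\mathcal T}_{\mathcal C}(m)})>0$ (read as $0$ if some $\mathcal R^{\mathcal T}_{\mathcal C}(m)=\infty$). Operators. For $g,h\in\Gamma$ let $H(g,h)=\langle\delta_g,H\delta_h\rangle$. $H$ has finite hopping range if there is $M\in\mathbb N$ with $H(g,h)=0$ whenever $d_S(g,h)\ge M$. $H$ is $\mathcal C$-invariant if there is $N\in\mathbb N$ such that $H(xg,xh)=H(g,h)$ for all $x,g,h\in\Gamma$ with $\mathcal C(xy)=\mathcal C(y)$ for all $y\in B_N(g)\cup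 B_N(h)$. For such $M,N$ the overall range is $R=\max\{M,N\}$. For finite $F\subseteq\Gamma$ put $F^R=\{x\in F:B_{R+1}(x)\subseteq F\}$. For finite $L\subseteq\Gamma$ let $H[L]=p_LHi_L:\ell^2(L)\to\ell^2(L)$, with $i_L$ extension by zero and $p_L$ restriction. Put $H_m=H[(T_m^{-1})^R]$ and $$N_{H_m}(E)=\frac{1}{m_\Gamma(T_m^{-1})}\#\{\text{eigenvalues }\lambda\le E\text{ of }H_m,\text{ counted with multiplicity}\},\quad E\in\mathbb R.$$ $\|\cdot\|_\infty$ is the supremum norm on $\mathbb R$. *)

(* Defs.v *)
From HB Require Import structures.
From mathcomp Require Import all_boot all_order all_algebra finmap complex.
From mathcomp Require Import all_classical all_reals all_analysis.
From mathcomp Require Import lra.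
From mathcomp.analysis.showcase Require Import summability.

Set Implicit Arguments.
Unset Strict Implicit.
Unset Printing Implicit Defensive.

Import Order.TTheory GRing.Theory Num.Theory.
Import numFieldNormedType.Exports.

Local Open Scope classical_set_scope.
Local Open Scope ring_scope.
Local Open Scope complex_scope.

(* The infimum of a set of natural numbers in N u {oo}, [None] being oo. *)
Definition nat_inf (P : set nat) : option nat :=
  match pselect (exists n, `[< P n >]) with
  | left exP => Some (ex_minn exP)
  | right _ => None
  end.

Section Groups.
Variable G : groupType.
Implicit Types (g h x y : G) (S F K T : {fset G}).

Definition translate g F : {fset G} := [fset (g * x)%g | x in F]%fset.

Definition set_inverse F : {fset G} := [fset (x^-1)%g | x in F]%fset.

Definition set_product K F : {fset G} := [fset (k * x)%g | k in K, x in F]%fset.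

Definition symdiff F K : {fset G} := ((F `\` K) `|` (K `\` F))%fset.

Definition symmetric_subset S : Prop := forall s, s \in S -> (s^-1)%g \in S.

Definition is_word S (L : nat) g : Prop :=
  exists2 w : L.-tuple G, {subset w <= S} & (\big[*%g/1%g]_(s <- w) s)%g = g.

Definition generates S : Prop := forall g, exists L, is_word S L g.

(* The default value [0] is never used when [S] generates the group. *)
Definition word_metric S g h : nat :=
  odflt 0%N (nat_inf [set L | is_word S L (g^-1 * h)%g]).

Definition word_ball S (n : nat) g : set G :=
  [set h | (word_metric S g h < n)%N].

Definition boundary K T : set G :=
  [set g | (exists2 k, k \in K & (k * g)%g \in T) /\
           (exists2 k, k \in K & (k * g)%g \notin T)].

(* Hence [fset_set (boundary K T)] does not take its junk value. *)
Lemma finite_boundary K T : finite_set (boundary K T).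
Proof.
apply: (@sub_finite_set _ _ [set` set_product (set_inverse K) T]); last first.
  exact: finite_fset.
move=> g [[k kK kgT] _] /=; apply/imfset2P.
exists (k^-1)%g; first by apply/imfsetP; exists k.
by exists (k * g)%g => //; rewrite mulKg.
Qed.

Section Folner.
Variable R : realType.

Definition amenable : Prop :=
  exists F : nat -> {fset G}, (forall n, F n != fset0) /\
    forall K, K != fset0 ->
      (fun n => #|` symdiff (F n) (set_product K (F n))|%:R / #|` F n|%:R : R)
        @ \oo --> (0 : R).

Record strong_folner_exhaustion (T : nat -> {fset G}) : Prop :=
  StrongFolnerExhaustion {
    sfe_id : forall m, 1%g \in T m;
    sfe_increasing : forall m, (T m `<=` T m.+1)%fset;
    sfe_exhausts : forall g, exists m, g \in T m;
    sfe_folner : forall K, K != fset0 ->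
      (fun m => #|` symdiff (T m) (set_product K (T m))|%:R / #|` T m|%:R : R)
        @ \oo --> (0 : R);
    sfe_boundary : forall K,
      (fun m => #|` fset_set (boundary K (T m))|%:R / #|` T m|%:R : R)
        @ \oo --> (0 : R) }.

End Folner.

Section Colorings.
Variables (A : finType) (C : G -> A).

(* Since [C] is fixed, the patch C|_F is represented by its support F; a
   pattern is then the set of the supports of its representatives. *)
Definition patch_equiv F F' : Prop :=
  exists2 g, translate g F = F' & forall s, s \in F -> C (g * s)%g = C s.

Definition pattern F : set {fset G} := [set F' | patch_equiv F F'].

Definition patterns F : set (set {fset G}) :=
  [set pattern (translate g F) | g in [set: G]].

(* For [p \in patterns F]; representatives of such a [p] have the form xF. *)
Definition occurs_in F (p : set {fset G}) T : Prop :=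
  exists x g, [/\ p (translate x F),
    (translate g (translate x F) `<=` T)%fset &
    forall s, s \in F -> C (g * x * s)%g = C (x * s)%g].

Variable T : nat -> {fset G}.

Definition repetitivity (m : nat) : option nat :=
  nat_inf [set n | forall p, patterns (set_inverse (T m)) p ->
    forall g, occurs_in (set_inverse (T m)) p (translate g (set_inverse (T n)))].

Definition tempered_repetitive (R : realType) : Prop :=
  0 < inf (range (fun m : nat =>
    if repetitivity m is Some n then #|` T m|%:R / #|` T n|%:R else 0 : R)).

End Colorings.
End Groups.

Section SquareSummable.
Variables (G : choiceType) (R : realType).

Definition square_summable : {pred G -> R[i]} := fun u =>
  `[< (\esum_(g in [set: G]) (Normc.normc (u g) ^+ 2)%:E < +oo)%E >].

Lemma square_summableP (u : G -> R[i]) :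
  reflect (\esum_(g in [set: G]) (Normc.normc (u g) ^+ 2)%:E < +oo)%E
          (u \in square_summable).
Proof. exact: asboolP. Qed.

Lemma square_summable_submod : subsemimod_closed square_summable.
Proof.
pose a (w : G -> R[i]) g : \bar R := (Normc.normc (w g) ^+ 2)%:E.
have a0 w g : (0 <= a w g)%E by rewrite lee_fin sqr_ge0.
split; first split.
- apply/square_summableP; rewrite esum1 // => g _.
  by rewrite Normc.normc0 expr0n.
- move=> u v /square_summableP su /square_summableP sv; apply/square_summableP.
  apply: (@le_lt_trans _ _
    (\esum_(g in [set: G]) ((a u g + a u g) + (a v g + a v g)))%E).
    apply: le_esum => g _; rewrite /a -!EFinD lee_fin.
    have h1 : Normc.normc (u g + v g) <= Normc.normc (u g) + Normc.normc (v g).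
      exact: le_normcD.
    have h0 : 0 <= Normc.normc (u g + v g).
      by case: (u g + v g) => x y /=; exact: sqrtr_ge0.
    have := sqr_ge0 (Normc.normc (u g) - Normc.normc (v g)).
    have := ler_pM h0 h0 h1 h1; rewrite -!expr2 => h2 h3.
    apply: le_trans h2 _; rewrite sqrrD.
    by move: h3; rewrite sqrrB; lra.
  by rewrite !esumD ?lte_add_pinfty // => *; rewrite ?adde_ge0.
- move=> c u /square_summableP su; apply/square_summableP.
  apply: (@le_lt_trans _ _ ((Normc.normc c ^+ 2)%:E *
    \esum_(g in [set: G]) a u g)%E).
    apply: ge_ereal_sup => _ [X [finX _] <-].
    rewrite (eq_fsbigr (fun g => (Normc.normc c ^+ 2)%:E * a u g)%E).
      rewrite -ge0_mule_fsumr //; apply: lee_wpmul2l.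
        by rewrite lee_fin sqr_ge0.
      by apply: ereal_sup_ubound; exists X.
    by move=> g _; rewrite /a -EFinM -exprMn -Normc.normcM.
  have : (\esum_(g in [set: G]) a u g \is a fin_num)%E.
    by rewrite ge0_fin_numE // esum_ge0.
  by move=> /fineK <-; rewrite -EFinM ltry.
Qed.

HB.instance Definition _ :=
  GRing.isSubmodClosed.Build _ _ square_summable square_summable_submod.

Record ell2 := Ell2 {
  ell2_fun :> G -> R[i];
  ell2_subproof : ell2_fun \in square_summable }.

HB.instance Definition _ := [isSub for ell2_fun].
HB.instance Definition _ := [Choice of ell2 by <:].
HB.instance Definition _ := [SubChoice_isSubLmodule of ell2 by <:].

Lemma square_summable_finite_support (F : {fset G}) (u : G -> R[i]) :
  (forall g, g \notin F -> u g = 0) -> u \in square_summable.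
Proof.
move=> u0; apply/square_summableP.
rewrite (eq_esum (b := fun g => if g \in [set` F]
    then (Normc.normc (u g) ^+ 2)%:E else 0%E)); last first.
  move=> g _; case: ifPn; rewrite mem_setE// => /u0 ->.
  by rewrite Normc.normc0 expr0n.
rewrite -esum_mkcondr setTI esum_fset; last 2 first.
- exact: finite_fset.
- by move=> *; rewrite lee_fin sqr_ge0.
by rewrite fsumEFin ?ltry //; exact: finite_fset.
Qed.

(* Unordered sum; [R[i]^o] carries the topology of the field R[i]. *)
Definition inner_product (u v : ell2) : R[i] :=
  summability.sum (fun g => (u g)^* * v g : R[i]^o).

Definition delta_fun (g h : G) : R[i] := (h == g)%:R.

Lemma delta_subproof g : delta_fun g \in square_summable.
Proof.
apply: (@square_summable_finite_support [fset g]%fset) => h.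
by rewrite inE /delta_fun => /negbTE ->.
Qed.

Definition ell2_delta g : ell2 := Ell2 (delta_subproof g).

(* By Hellinger-Toeplitz, these are the bounded self-adjoint operators. *)
Definition self_adjoint (H : ell2 -> ell2) : Prop :=
  forall u v, inner_product (H u) v = inner_product u (H v).

Definition matrix_element (H : ell2 -> ell2) (g h : G) : R[i] :=
  inner_product (ell2_delta g) (H (ell2_delta h)).

Lemma matrix_elementE (H : ell2 -> ell2) g h :
  matrix_element H g h = H (ell2_delta h) g.
Proof.
rewrite /matrix_element /inner_product /summability.sum.
apply: (@lim_near_cst R[i]^o); [exact: norm_hausdorff|exact: totally_filter|].
exists [fset g]%fset => //= B /=.
rewrite fsub1set => gB.
rewrite /partial_sum (bigD1 [` gB]%fset) //= big1 => [|x xg].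
  by rewrite /delta_fun eqxx conjC1 mul1r addr0.
by rewrite /delta_fun (_ : (val x == g) = false) ?conjC0 ?mul0r //; apply/negbTE.
Qed.

Section Compression.
Variables (H : {linear ell2 -> ell2}) (L : {fset G}).

Definition extend_fun (u : {ffun L -> R[i]^o}) (g : G) : R[i] :=
  oapp u 0 (insub g).

Lemma extend_subproof u : extend_fun u \in square_summable.
Proof.
apply: (@square_summable_finite_support L) => g gL.
by rewrite /extend_fun insubN.
Qed.

Definition ell2_extend u : ell2 := Ell2 (extend_subproof u).

Definition ell2_restrict (v : ell2) : {ffun L -> R[i]^o} :=
  [ffun x => v (val x)].

Definition compression_fun (u : {ffun L -> R[i]^o}) : {ffun L -> R[i]^o} :=
  ell2_restrict (H (ell2_extend u)).

Lemma compression_is_linear : linear compression_fun.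
Proof.
move=> c u v; have -> : compression_fun (c *: u + v) =
    ell2_restrict (H (c *: ell2_extend u + ell2_extend v)).
  congr (ell2_restrict (H _)); apply: val_inj; apply/funext => g.
  transitivity (c * extend_fun u g + extend_fun v g); last by [].
  rewrite /= /extend_fun; case: insubP => [x _ _|_] /=; first by rewrite !ffunE.
  by rewrite mulr0 addr0.
by rewrite linearP; apply/ffunP => x; rewrite !ffunE.
Qed.

HB.instance Definition _ :=
  GRing.isLinear.Build _ _ _ _ compression_fun compression_is_linear.

Definition compression : 'End({ffun L -> R[i]^o}) := linfun compression_fun.

(* Compressions of self-adjoint operators have real eigenvalues, and the
   multiplicity of an eigenvalue is the dimension of its eigenspace.
   Only finitely many terms of the sum are nonzero. *)
Definition eigenvalue_count (E : R) : nat :=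
  (\sum_(x \in [set x : R | (x <= E)%R])
     \dim (passmx.leigenspace compression x%:C))%N.

End Compression.
End SquareSummable.

Section Operators.
Variables (G : groupType) (S : {fset G}) (R : realType).
Variable H : {linear ell2 G R -> ell2 G R}.

Definition hopping_range (M : nat) : Prop :=
  forall g h, (M <= word_metric S g h)%N -> matrix_element H g h = 0.

Definition invariance_range (A : finType) (C : G -> A) (N : nat) : Prop :=
  forall x g h,
    (forall y, (word_ball S N g `|` word_ball S N h) y -> C (x * y)%g = C y) ->
    matrix_element H (x * g)%g (x * h)%g = matrix_element H g h.

Definition finite_hopping_range : Prop := exists M, hopping_range M.

Definition coloring_invariant (A : finType) (C : G -> A) : Prop :=
  exists N, invariance_range C N.

(* {x in F | B_{r+1}(x) included in F} *)
Definition shrink (r : nat) (F : {fset G}) : {fset G} :=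
  [fset x in F | `[< forall y, word_ball S r.+1 x y -> y \in F >]]%fset.

Definition empirical_distribution (T : nat -> {fset G}) (r m : nat) (E : R) :
    R :=
  (eigenvalue_count H (shrink r (set_inverse (T m))) E)%:R
    / #|` set_inverse (T m)|%:R.

End Operators.

(* Main.v *)
From HB Require Import structures.
Require Import Defs.
From mathcomp Require Import all_boot all_order all_algebra finmap complex.
From mathcomp Require Import all_classical all_reals all_analysis.
From mathcomp Require Import ring lra perm.
From mathcomp.analysis.showcase Require Import summability.

Set Implicit Arguments.
Unset Strict Implicit.
Unset Printing Implicit Defensive.

Import Order.TTheory GRing.Theory Num.Theory.
Import numFieldNormedType.Exports.

Local Open Scope classical_set_scope.
Local Open Scope ring_scope.

(** Write b(Q)(E) for the number of eigenvalues at most E of the compression of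
    H to the R-interior of a finite set Q.  Two features of b matter.  It is
    local: b(gQ) = b(Q) whenever the coloring does not distinguish Q from gQ
    ([shrunk_count_local]).  It is almost additive, uniformly in E: if Q is
    partitioned, then the compressions to the interiors of the pieces do not
    interact, and passing to the union of these interiors removes from the
    interior of Q only points near a boundary, each of which changes the
    counting function by at most one ([shrunk_count_pieces], from the
    min-max comparison [level_count_embed]).

    To exploit this one needs partitions of the sets F_m = T_m^-1 into pieces of
    bounded size with few boundary points.  They are obtained at random.  Fix a
    tile T0 = T_j and a uniformly random linear order on a large finite set of
    labels; send a point x to the least element of x T0.  The points x and xk
    are separated only if the least element of the union of x T0 and xk T0 lies
    in their symmetric difference.  This has probability at most the quotient of
    the cardinals of the symmetric difference of T0 and k T0 and of T0, which is
    small because T0 is a Folner set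
    ([sum_uncovered]).  The piece with center g lies in g T0^-1, and its
    distribution relative to g does not depend on g.  Hence the expected value
    of b on it is a function phi of the coloring on g T0^-1
    ([sum_piece_pattern]), and b(F_m)/|F_m| is, up to a small error that is
    uniform in E, the average of phi over the centers g in F_m.

    It remains to see that averages over F_m of functions of finite patterns
    converge ([local_average_cvg]).  For a local f with values in [0, 1] let M
    be the infimum over k of the largest average of f over a translate of F_k;
    by the Folner property every translate of F_m, m large, has average at most
    M + eps.  Let M' be the same number for 1 - f.  Some translate of F_m has
    average at most 1 - M' + eps; tempered repetitivity puts a copy of it,
    occupying a proportion at least c, into every translate of F_n for a
    suitable n, and the rest of that translate again has average at most
    M + eps.  So M is at most c (1 - M') + (1 - c) M, up to small errors, hence
    M + M' <= 1 ([upper_mean_complement]) and the averages converge to M.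

    Consequently the empirical distributions form a Cauchy sequence for the
    supremum norm ([empirical_cauchy]).  Their limit inherits right continuity
    and the range [0, 1], and it does not depend on the chosen overall range,
    since two choices differ near the boundary of F_m only
    ([near_empirical_range]). *)

(** * Hermitian kernels and their eigenbases *)

Section HermitianForms.
Local Open Scope complex_scope.
Local Open Scope sesquilinear_scope.
Variables (R : realType) (I : finType).
Local Notation V := {ffun I -> R[i]^o}.

Definition dot (u v : V) : R[i] := \sum_x ((u x)^* * v x)%R.

Variable a : I -> I -> R[i].
Hypothesis a_herm : forall x y, a y x = ((a x y)^*)%R.

(** The spectral theorem for matrices, transported to functions on an
    arbitrary finite type.  Indexing the basis by I itself avoids enumerations
    later on. *)
Lemma orthonormal_eigenbasis :
  exists (e : I -> V) (d : I -> R),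
  [/\ forall i j, dot (e i) (e j) = (i == j)%:R,
      forall u, u = \sum_i (dot (e i) u) *: e i &
      forall i x, \sum_y a x y * e i y = (d i)%:C * e i x].
Proof.
pose A := \matrix_(i < #|I|, j < #|I|) a (enum_val i) (enum_val j).
have Ah : A \is hermsymmx.
  apply/is_hermitianmxP/matrixP => i j.
  by rewrite expr0 scale1r !mxE -a_herm.
have /orthomx_spectralP := hermitian_normalmx Ah.
have Dr := hermitian_spectral_diag_real Ah.
have Pu := spectral_unitarymx A.
move: (spectralmx A) (spectral_diag A) Pu Dr => P D Pu Dr AE.
have PP : P *m P^t* = 1%:M by apply/unitarymxP.
have PP' : P^t* *m P = 1%:M by exact: mulmx1C.
pose e i : V := [ffun x => (P (enum_rank i) (enum_rank x))^*%R].
have sumr (F : 'I_#|I| -> R[i]) : \sum_x F (enum_rank x) = \sum_i F i.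
  by rewrite [RHS](reindex enum_rank) //; exists enum_val => i _;
    rewrite ?enum_rankK ?enum_valK.
exists e, (fun i => complex.Re (D 0 (enum_rank i))); split.
- move=> i j; rewrite -(inj_eq enum_rank_inj).
  have /matrixP/(_ (enum_rank i) (enum_rank j)) := PP.
  rewrite !mxE => <-; rewrite -sumr; apply: eq_bigr => x _.
  by rewrite !ffunE conjCK !mxE.
- move=> u; apply/ffunP => x; rewrite sum_ffunE.
  under eq_bigr do rewrite ffunE /dot scaler_suml.
  rewrite exchange_big /=.
  have h y : \sum_i ((e i y)^*)%R * u y * e i x = (x == y)%:R * u y.
    rewrite -(inj_eq enum_rank_inj).
    have /matrixP/(_ (enum_rank x) (enum_rank y)) := PP'.
    rewrite !mxE => <-; rewrite -sumr mulr_suml; apply: eq_bigr => i _.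
    by rewrite !ffunE conjCK !mxE mulrC mulrA.
  rewrite (eq_bigr _ (fun y _ => h y)).
  rewrite (bigD1 x)//= eqxx mul1r big1 ?addr0// => y /negbTE.
  by rewrite eq_sym => ->; rewrite mul0r.
- move=> i x.
  have AP : A *m P^t* = P^t* *m diag_mx D.
    by rewrite AE invmx_unitary// -!mulmxA PP mulmx1.
  have /matrixP/(_ (enum_rank x) (enum_rank i)) := AP.
  rewrite mul_mx_diag [RHS]mxE !mxE -sumr => h.
  transitivity (\sum_(x0 : I)
    A (enum_rank x) (enum_rank x0) * P^t* (enum_rank x0) (enum_rank i)).
    by apply: eq_bigr => y _; rewrite !mxE !enum_rankK ffunE.
  rewrite h ffunE mulrC; congr (_ * _).
  have /mxOverP/(_ 0 (enum_rank i)) := Dr.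
  move: (D 0 _) => z; by case: z => p q; rewrite complex_real => /eqP ->.
Qed.
End HermitianForms.

Section DotLinear.
Variables (R : realType) (I : finType).
Local Open Scope complex_scope.
Local Notation V := {ffun I -> R[i]^o}.

Lemma dot_is_linear (u : V) : linear (dot u : V -> R[i]^o).
Proof.
move=> c v w; rewrite /dot scaler_sumr -big_split /=.
by apply: eq_bigr => x _; rewrite !ffunE mulrDr; congr (_ + _); exact: mulrCA.
Qed.

HB.instance Definition _ (u : V) :=
  GRing.isLinear.Build R[i] V R[i]^o _ (dot u) (@dot_is_linear u).

Lemma dotC (u v : V) : dot v u = ((dot u v)^*)%R.
Proof.
rewrite /dot rmorph_sum; apply: eq_bigr => x _.
by rewrite rmorphM /= conjCK mulrC.
Qed.

End DotLinear.

Lemma memv_leigenspace (K : fieldType) (vT : vectType K) (f : 'End(vT)) c u :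
  (u \in passmx.leigenspace f c) = (f u == c *: u).
Proof.
by rewrite memv_ker add_lfunE opp_lfunE scale_lfunE id_lfunE subr_eq0.
Qed.

Section EigenCounting.
Variables (R : realType) (I : finType).
Local Open Scope complex_scope.
Local Notation V := {ffun I -> R[i]^o}.
Variables (e : I -> V) (d : I -> R) (f : 'End(V)).
Hypothesis e_orth : forall i j, dot (e i) (e j) = (i == j)%:R.
Hypothesis e_total : forall u, u = \sum_i (dot (e i) u) *: e i.
Hypothesis e_eigen : forall i, f (e i) = (d i)%:C *: e i.

Lemma dot_sum (c : I -> R[i]) j : dot (e j) (\sum_i c i *: e i) = c j.
Proof.
rewrite linear_sum (bigD1 j)//= linearZ /= e_orth eqxx big1 => [|i ij].
  by rewrite addr0; exact: mulr1.
by rewrite linearZ /= e_orth eq_sym (negbTE ij); exact: mulr0.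
Qed.

Lemma dot_eigen u i : dot (e i) (f u) = (d i)%:C * dot (e i) u.
Proof.
rewrite {1}(e_total u) linear_sum.
under eq_bigr do rewrite linearZ /= e_eigen scalerA.
by rewrite dot_sum mulrC.
Qed.

Lemma parseval u v : dot u v = \sum_i ((dot (e i) u)^* * dot (e i) v)%R.
Proof.
rewrite {1}(e_total v) linear_sum; apply: eq_bigr => i _.
by rewrite linearZ /= [LHS]mulrC dotC.
Qed.

Definition coord_proj (P : pred I) (u : V) : V :=
  \sum_(i | P i) (dot (e i) u) *: e i.

Lemma coord_proj_is_linear P : linear (coord_proj P).
Proof.
move=> c u v; rewrite /coord_proj scaler_sumr -big_split /=.
by apply: eq_bigr => i _; rewrite linearP scalerDl scalerA.
Qed.

HB.instance Definition _ P :=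
  GRing.isLinear.Build R[i] V V _ (coord_proj P) (@coord_proj_is_linear P).

(** The span of the [e i] with [P i], presented as a kernel so that membership
    is a condition on coordinates. *)
Definition coord_space (P : pred I) : {vspace V} := lker (linfun (coord_proj (predC P))).

Lemma coord_spaceP (P : pred I) u :
  reflect (forall i, ~~ P i -> dot (e i) u = 0) (u \in coord_space P).
Proof.
rewrite memv_ker lfunE /=; apply: (iffP eqP) => [u0 i Pi|u0].
  have := dot_sum (fun i => if ~~ P i then dot (e i) u else 0) i.
  rewrite Pi => <-; apply: etrans (linear0 (dot (e i))); congr dot.
  rewrite -[RHS]u0 /coord_proj [RHS]big_mkcond; apply: eq_bigr => j _ /=.
  by case: ifP; rewrite ?scale0r.
by rewrite /coord_proj big1 // => i /u0 ->; rewrite scale0r.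
Qed.

Lemma dim_coord_space_le P : (\dim (coord_space P) <= #|P|)%N.
Proof.
have le : (coord_space P <= <<[seq e i | i in P]>>)%VS.
  apply/subvP => u /coord_spaceP u0; rewrite (e_total u).
  apply: memv_suml => i _; have [Pi|/u0 ->] := boolP (P i).
    by apply/memvZ/memv_span/mapP; exists i; rewrite ?mem_enum.
  by rewrite scale0r mem0v.
by rewrite (leq_trans (dimvS le)) // (leq_trans (dim_span _)) // size_image.
Qed.

(** The spaces of P and of its complement together span everything and have
    dimensions at most the cardinals of the two predicates, so both bounds are
    equalities. *)
Lemma dim_coord_space P : \dim (coord_space P) = #|P|.
Proof.
apply/eqP; rewrite eqn_leq dim_coord_space_le /=.
have full : (fullv <= coord_space P + coord_space (predC P))%VS.
  apply/subvP => u _; rewrite (e_total u) (bigID P) /=.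
  apply: memv_add; apply/coord_spaceP => i /= Pi.
    rewrite linear_sum big1 // => j Pj; rewrite linearZ /= e_orth.
    by case: eqP Pj Pi => [->|_ _ _]; [case: (P j)|exact: mulr0].
  rewrite linear_sum big1 // => j Pj; rewrite linearZ /= e_orth.
  by case: eqP Pj Pi => [->|_ _ _]; [case: (P j)|exact: mulr0].
have := dimvS full; rewrite dimvf /dim /= muln1 => le.
have := leq_trans le (dimv_add_leqif _ _).
have := dim_coord_space_le (predC P).
rewrite -(cardC P) => h1 h2.
by rewrite -(leq_add2r #|predC P|) (leq_trans h2) // leq_add2l.
Qed.

Lemma leigenspace_coord x :
  passmx.leigenspace f x%:C = coord_space (fun i => d i == x).
Proof.
apply/vspaceP => u; apply: (etrans (memv_leigenspace f _ u)).
apply/eqP/coord_spaceP => [fu i dx|u0].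
  have := dot_eigen u i; rewrite fu linearZ /= => /eqP.
  rewrite -subr_eq0 -mulrBl mulf_eq0 -rmorphB /= => /orP[|/eqP //].
  by rewrite fmorph_eq0 subr_eq0 eq_sym (negbTE dx).
rewrite {1}(e_total u) {2}(e_total u) linear_sum scaler_sumr.
apply: eq_bigr => i _; rewrite linearZ /= e_eigen.
have [<-|dx] := eqVneq (d i) x; first by rewrite !scalerA mulrC.
rewrite (u0 _ dx); transitivity (0 : V); first exact: scale0r.
by rewrite scale0r; apply/esym; exact: scaler0.
Qed.

(** Any orthonormal eigenbasis computes the counting function; this is applied
    to bases that are assembled from smaller ones. *)
Lemma sum_dim_leigenspace E :
  (\sum_(x \in [set x : R | (x <= E)%R])
     \dim (passmx.leigenspace f x%:C))%N = #|[pred i | d i <= E]|.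
Proof.
pose r := [seq x <- undup [seq d i | i : I] | x <= E].
rewrite (@fsbigE _ _ _ _ _ r).
- transitivity (\sum_(x <- r) \sum_i (d i == x)%N)%N.
    rewrite [LHS]big_seq_cond [RHS]big_seq; apply: eq_big => x.
      by rewrite mem_filter; case: (boolP (x <= E)) => //= xE; rewrite mem_set ?andbT.
    move=> _; rewrite leigenspace_coord dim_coord_space.
    by rewrite -sum1_card big_mkcond; apply: eq_bigr => i _; rewrite unfold_in; case: eqP.
  rewrite exchange_big /= -sum1_card [RHS]big_mkcond; apply: eq_bigr => i _.
  rewrite inE.
  transitivity (count_mem (d i) r).
    elim: r => [|x r IH]; rewrite ?big_nil// big_cons IH /=.
    by rewrite eq_sym.
  rewrite count_uniq_mem ?filter_uniq ?undup_uniq // mem_filter mem_undup.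
  by rewrite fintype.image_f // andbT; case: ifP.
- by rewrite filter_uniq ?undup_uniq.
- by move=> x /=; rewrite mem_filter => /andP[].
- move=> x /= xE; rewrite mem_filter xE /= mem_undup => xd.
  rewrite leigenspace_coord dim_coord_space; apply: eq_card0 => i.
  apply/negbTE; apply: contra xd => /eqP <-; exact: fintype.image_f.
Qed.

Lemma quad_coord u : dot u (f u) = \sum_i (d i)%:C * `|dot (e i) u| ^+ 2.
Proof.
rewrite parseval; apply: eq_bigr => i _.
by rewrite dot_eigen mulrCA normCK [_^*%R * _]mulrC.
Qed.

Lemma norm_coord u : dot u u = \sum_i `|dot (e i) u| ^+ 2.
Proof.
by rewrite parseval; apply: eq_bigr => i _; rewrite normCK mulrC.
Qed.

Lemma quad_le (E : R) u : u \in coord_space (fun i => d i <= E) ->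
  dot u (f u) <= E%:C * dot u u.
Proof.
move=> /coord_spaceP u0; rewrite quad_coord norm_coord mulr_sumr.
apply: ler_sum => i _; have [dE|/u0 ->] := boolP (d i <= E).
  by rewrite ler_wpM2r ?exprn_ge0// lecR.
by rewrite normr0 expr0n !mulr0.
Qed.

Lemma quad_gt (E : R) u : u \in coord_space (fun i => ~~ (d i <= E)) ->
  u != 0 -> E%:C * dot u u < dot u (f u).
Proof.
move=> /coord_spaceP u0 un0; rewrite quad_coord norm_coord mulr_sumr.
have [i ui] : exists i, dot (e i) u != 0.
  apply: contrapT => h; case/eqP: un0; rewrite (e_total u) big1// => i _.
  have [->|ui] := eqVneq (dot (e i) u) 0; first by rewrite scale0r.
  by case: h; exists i.
rewrite [ltLHS](bigD1 i)//= [ltRHS](bigD1 i)//=; apply: ltr_leD.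
  rewrite ltr_pM2r ?exprn_gt0 ?normr_gt0// ltcR ltNge.
  by apply: contra ui => di; rewrite u0 // di.
apply: ler_sum => j _; have [dE|] := boolP (~~ (d j <= E)).
  by rewrite ler_wpM2r ?exprn_ge0// lecR ltW // ltNge.
by move=> /u0 ->; rewrite normr0 expr0n !mulr0.
Qed.

End EigenCounting.

(** * Comparison of eigenvalue counting functions *)

Section KernelOperators.
Variables (R : realType).
Local Open Scope complex_scope.

Section OneKernel.
Variables (I : finType) (a : I -> I -> R[i]).
Local Notation V := {ffun I -> R[i]^o}.

Definition kernel_fun (u : V) : V := [ffun x => \sum_y a x y * u y].

Lemma kernel_fun_is_linear : linear kernel_fun.
Proof.
move=> c u v; apply/ffunP => x; rewrite !ffunE scaler_sumr -big_split /=.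
apply: eq_bigr => y _; rewrite !ffunE mulrDr; congr (_ + _); exact: mulrCA.
Qed.

HB.instance Definition _ :=
  GRing.isLinear.Build R[i] V V _ kernel_fun kernel_fun_is_linear.

Definition kernel_op : 'End(V) := linfun kernel_fun.

Definition level_count (E : R) : nat :=
  (\sum_(x \in [set x : R | (x <= E)%R])
     \dim (passmx.leigenspace kernel_op x%:C))%N.

Definition hermitian_kernel := forall x y, a y x = ((a x y)^*)%R.

Lemma kernel_opE u x : kernel_op u x = \sum_y a x y * u y.
Proof. by rewrite lfunE /= ffunE. Qed.

Lemma kernel_spectrum : hermitian_kernel ->
  exists (e : I -> V) (d : I -> R),
  [/\ forall i j, dot (e i) (e j) = (i == j)%:R,
      forall u, u = \sum_i (dot (e i) u) *: e i,
      forall i, kernel_op (e i) = (d i)%:C *: e i &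
      forall E, level_count E = #|[pred i | d i <= E]|].
Proof.
move=> ah; have [e [d [orth total eigen]]] := orthonormal_eigenbasis ah.
have eigen' i : kernel_op (e i) = (d i)%:C *: e i.
  by apply/ffunP => x; rewrite kernel_opE eigen ffunE.
exists e, d; split => // E; exact: (sum_dim_leigenspace orth total eigen').
Qed.

End OneKernel.

Section Embedding.
Variables (I J : finType) (a : I -> I -> R[i]) (b : J -> J -> R[i]) (j : I -> J).
Hypothesis j_inj : injective j.
Hypothesis abj : forall x y, b (j x) (j y) = a x y.

(** Transport of functions along j; extension by zero when j is injective. *)
Definition push (u : {ffun I -> R[i]^o}) : {ffun J -> R[i]^o} :=
  [ffun y => \sum_(x | j x == y) u x].

Lemma push_is_linear : linear push.
Proof.
move=> c u v; apply/ffunP => y; rewrite !ffunE scaler_sumr -big_split /=.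
by apply: eq_bigr => x _; rewrite !ffunE.
Qed.

HB.instance Definition _ := GRing.isLinear.Build R[i] {ffun I -> R[i]^o}
  {ffun J -> R[i]^o} _ push push_is_linear.

Lemma push_im u x : push u (j x) = u x.
Proof.
rewrite ffunE (big_pred1 x) // => y /=; exact: inj_eq.
Qed.

Lemma sum_push (u : {ffun I -> R[i]^o}) (F : J -> R[i]) :
  \sum_y F y * push u y = \sum_x F (j x) * u x.
Proof.
under eq_bigr do rewrite ffunE mulr_sumr.
rewrite (exchange_big_dep predT) //=; apply: eq_bigr => x _.
by rewrite (big_pred1 (j x)) // => y; rewrite eq_sym.
Qed.

Lemma dot_push (u : {ffun I -> R[i]^o}) w :
  dot (push u) w = \sum_x ((u x)^* * w (j x))%R.
Proof.
rewrite dotC /dot rmorph_sum /=.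
transitivity (\sum_y w y * (push u y)^*)%R.
  by apply: eq_bigr => y _; rewrite rmorphM /= conjCK.
transitivity ((\sum_y (w y)^* * push u y)^*)%R.
  by rewrite rmorph_sum; apply: eq_bigr => y _; rewrite rmorphM /= conjCK.
rewrite sum_push rmorph_sum; apply: eq_bigr => y _.
by rewrite rmorphM /= conjCK mulrC.
Qed.

Lemma quad_push u :
  dot (push u) (kernel_op b (push u)) = dot u (kernel_op a u).
Proof.
rewrite dot_push; apply: eq_bigr => x _; congr (_ * _).
rewrite !kernel_opE sum_push; apply: eq_bigr => y _.
by rewrite abj.
Qed.

Lemma norm_push u : dot (push u) (push u) = dot u u.
Proof. by rewrite dot_push; apply: eq_bigr => x _; rewrite push_im. Qed.

(** The hypothesis says that the image of U meets W trivially. *)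
Lemma dim_push_disjoint (U : {vspace {ffun I -> R[i]^o}})
    (W : {vspace {ffun J -> R[i]^o}}) :
  (forall u, u \in U -> push u \in W -> push u = 0) ->
  (\dim U + \dim W <= #|J|)%N.
Proof.
move=> UW.
have -> : \dim U = \dim (linfun push @: U).
  apply/esym/limg_dim_eq/eqP; rewrite -subv0; apply/subvP => u.
  rewrite memv_cap memv_ker lfunE memv0 => /andP[_ /eqP pu].
  by apply/eqP/ffunP => x; rewrite -push_im pu !ffunE.
have : ((linfun push @: U) :&: W = 0)%VS.
  apply/eqP; rewrite -subv0; apply/subvP => w.
  rewrite memv_cap memv0 => /andP[/memv_imgP[u uU ->]].
  by rewrite lfunE /= => wW; apply/eqP/UW.
move=> /dimv_disjoint_sum <-.
by rewrite (leq_trans (dimvS (subvf _))) // dimvf /dim /= muln1.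
Qed.

(** Min-max.  The sub-E spectral space of the smaller kernel is mapped
    isometrically and preserves the quadratic form, so it meets the super-E
    spectral space of the larger kernel trivially; the dimension count gives the
    first inequality.  Exchanging the roles of the two spectral spaces gives the
    second, in which a smaller kernel is seen to lose at most one eigenvalue for
    each deleted point. *)
Lemma level_count_embed E : hermitian_kernel b ->
  (level_count a E <= level_count b E)%N /\
  (level_count b E + #|I| <= level_count a E + #|J|)%N.
Proof.
move=> bh; have ah : hermitian_kernel a by move=> x y; rewrite -!abj bh.
have [e [d [orth1 t1 g1 ->]]] := kernel_spectrum ah.
have [e' [d' [orth2 t2 g2 ->]]] := kernel_spectrum bh.
pose P i := d i <= E; pose Q i := d' i <= E.
have h1 := @dim_push_disjoint (coord_space e P) (coord_space e' (predC Q)).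
have h2 := @dim_push_disjoint (coord_space e (predC P)) (coord_space e' Q).
rewrite (dim_coord_space orth1 t1) (dim_coord_space orth2 t2) in h1.
rewrite (dim_coord_space orth1 t1) (dim_coord_space orth2 t2) in h2.
rewrite -(cardC P) -(cardC Q) in h1 h2 *.
split.
  rewrite -(leq_add2r #|predC Q|); apply: h1.
  move=> u uU pW; apply/eqP; apply: contraT => pn0.
  have := quad_gt orth2 t2 g2 pW pn0; rewrite quad_push norm_push.
  by have := quad_le orth1 t1 g1 uU; case: comparableP.
rewrite addnCA leq_add2l addnC; apply: h2.
move=> u uU pW; apply/eqP; apply: contraT => pn0.
have un0 : u != 0 by apply: contraNneq pn0 => ->; rewrite linear0.
have := quad_gt orth1 t1 g1 uU un0; have := quad_le orth2 t2 g2 pW.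
by rewrite quad_push norm_push; case: comparableP.
Qed.

End Embedding.

Section DirectSum.
Variables (I J : finType) (a : I -> I -> R[i]) (b : J -> J -> R[i]).

Definition sum_kernel (x y : I + J) : R[i] :=
  match x, y with
  | inl x, inl y => a x y
  | inr x, inr y => b x y
  | _, _ => 0
  end.

(** The eigenbases of the two blocks, extended by zero, form an eigenbasis of
    the direct sum. *)
Lemma level_count_sum E : hermitian_kernel a -> hermitian_kernel b ->
  level_count sum_kernel E = (level_count a E + level_count b E)%N.
Proof.
move=> ah bh.
have [e [d [orth1 t1 g1 ->]]] := kernel_spectrum ah.
have [e' [d' [orth2 t2 g2 ->]]] := kernel_spectrum bh.
pose il (u : {ffun I -> R[i]^o}) : {ffun I + J -> R[i]^o} :=
  [ffun z => if z is inl x then u x else 0].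
pose ir (u : {ffun J -> R[i]^o}) : {ffun I + J -> R[i]^o} :=
  [ffun z => if z is inr x then u x else 0].
pose f (i : I + J) := match i with inl i => il (e i) | inr i => ir (e' i) end.
pose c (i : I + J) := match i with inl i => d i | inr i => d' i end.
have dotil u w : dot (il u) w = dot u [ffun x => w (inl x)].
  rewrite /dot big_sumType /= [X in _ + X]big1 ?addr0.
    by apply: eq_bigr => x _; rewrite !ffunE.
  by move=> x _; rewrite ffunE conjC0 mul0r.
have dotir u w : dot (ir u) w = dot u [ffun x => w (inr x)].
  rewrite /dot big_sumType /= [X in X + _]big1 ?add0r.
    by apply: eq_bigr => x _; rewrite !ffunE.
  by move=> x _; rewrite ffunE conjC0 mul0r.
have ilK u : [ffun x => il u (inl x)] = u by apply/ffunP => x; rewrite !ffunE.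
have irK u : [ffun x => ir u (inr x)] = u by apply/ffunP => x; rewrite !ffunE.
have ilr u : [ffun x => il u (inr x)] = 0 by apply/ffunP => x; rewrite !ffunE.
have irl u : [ffun x => ir u (inl x)] = 0 by apply/ffunP => x; rewrite !ffunE.
rewrite /level_count (@sum_dim_leigenspace _ _ f c).
- rewrite -!sum1_card big_sumType /=.
  by congr (_ + _)%N; apply: eq_bigl => x.
- case=> x; case=> y /=.
  + by rewrite dotil ilK orth1.
  + by rewrite dotil irl linear0.
  + by rewrite dotir ilr linear0.
  + by rewrite dotir irK orth2.
- move=> u; apply/ffunP => z; rewrite sum_ffunE big_sumType /=.
  case: z => x.
    rewrite [X in _ + X]big1 ?addr0; last first.
      by move=> y _; rewrite !ffunE; exact: scaler0.
    have := t1 [ffun x => u (inl x)] => /ffunP/(_ x).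
    rewrite ffunE sum_ffunE => ->; apply: eq_bigr => y _.
    by rewrite dotil !ffunE.
  rewrite [X in X + _]big1 ?add0r; last first.
    by move=> y _; rewrite !ffunE; exact: scaler0.
  have := t2 [ffun x => u (inr x)] => /ffunP/(_ x).
  rewrite ffunE sum_ffunE => ->; apply: eq_bigr => y _.
  by rewrite dotir !ffunE.
- case=> i; apply/ffunP; case=> x /=; rewrite kernel_opE big_sumType ffunE /=.
  + rewrite [X in _ + X]big1 ?addr0; last by move=> y _; rewrite mul0r.
    have /ffunP/(_ x) := g1 i; rewrite kernel_opE !ffunE => <-.
    by apply: eq_bigr => y _; rewrite ffunE.
  + rewrite !big1 ?addr0 ?ffunE => [|y _|y _]; rewrite ?ffunE ?mul0r ?mulr0//.
    by apply/esym; exact: mulr0.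
  + rewrite !big1 ?addr0 ?ffunE => [|y _|y _]; rewrite ?ffunE ?mul0r ?mulr0//.
    by apply/esym; exact: mulr0.
  + rewrite [X in X + _]big1 ?add0r; last by move=> y _; rewrite mul0r.
    have /ffunP/(_ x) := g2 i; rewrite kernel_opE !ffunE => <-.
    by apply: eq_bigr => y _; rewrite ffunE.
Qed.

End DirectSum.

End KernelOperators.

(** * Compressions of self-adjoint operators *)

Section CompressionCount.
Variables (G : choiceType) (R : realType) (H : {linear ell2 G R -> ell2 G R}).
Hypothesis H_sa : self_adjoint H.
Local Open Scope complex_scope.
Local Open Scope fset_scope.

(** Only one term of the unordered sum is nonzero, so the partial sums are
    eventually constant. *)
Lemma inner_product_delta (u : ell2 G R) h :
  inner_product u (ell2_delta R h) = ((u h)^*)%R.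
Proof.
rewrite /inner_product /summability.sum.
apply: (@lim_near_cst R[i]^o);
  [exact: norm_hausdorff|exact: totally_filter|].
exists [fset h]%fset => //= B /=.
rewrite fsub1set => hB.
rewrite /partial_sum (bigD1 [` hB]%fset) //= big1 => [|x xh].
  by rewrite /delta_fun eqxx mulr1 addr0.
by rewrite /delta_fun (_ : (val x == h) = false) ?mulr0 //; apply/negbTE.
Qed.

Lemma matrix_element_herm g h :
  matrix_element H h g = ((matrix_element H g h)^*)%R.
Proof.
rewrite [in LHS]matrix_elementE /matrix_element -H_sa inner_product_delta.
by rewrite conjCK.
Qed.

Definition sub_kernel (L : {fset G}) (x y : L) : R[i] :=
  matrix_element H (val x) (val y).

Lemma sub_kernel_herm L : hermitian_kernel (@sub_kernel L).
Proof. by move=> x y; exact: matrix_element_herm. Qed.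

Lemma ell2_extendE (L : {fset G}) (u : {ffun L -> R[i]^o}) :
  ell2_extend u = \sum_x u x *: ell2_delta R (val x).
Proof.
apply: val_inj; apply/funext => g.
have -> : val (\sum_x u x *: ell2_delta R (val x)) g =
    \sum_x u x * delta_fun R (val x) g.
  elim/big_rec2 : _ => // x y v _ <-.
  by [].
rewrite /= /extend_fun; case: insubP => [x gL xg|gL] /=.
  rewrite (bigD1 x)//= big1 => [|y yx].
    by rewrite /delta_fun -xg eqxx mulr1 addr0.
  by rewrite /delta_fun -xg (inj_eq val_inj) eq_sym (negbTE yx) mulr0.
rewrite big1 // => x _; rewrite /delta_fun.
by case: eqP gL => [->|_]; rewrite ?mulr0// (valP x).
Qed.

(** On finitely supported functions H acts through its matrix elements, by
    linearity alone. *)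
Lemma compression_kernel (L : {fset G}) :
  compression H L = kernel_op (@sub_kernel L).
Proof.
apply/lfunP => u; rewrite lfunE; apply/ffunP => x.
rewrite kernel_opE /= /compression_fun ffunE ell2_extendE linear_sum.
have -> : (\sum_y H (u y *: ell2_delta R (val y)) : ell2 G R) (val x) =
    \sum_y u y * H (ell2_delta R (val y)) (val x).
  rewrite (eq_bigr (fun y => u y *: H (ell2_delta R (val y)))); last first.
    by move=> y _; rewrite linearZ.
  by elim/big_rec2 : _ => // y z v _ <-.
by apply: eq_bigr => y _; rewrite /sub_kernel matrix_elementE mulrC.
Qed.

Lemma eigenvalue_countE L E :
  eigenvalue_count H L E = level_count (@sub_kernel L) E.
Proof. by rewrite /eigenvalue_count compression_kernel. Qed.

Lemma eigenvalue_count_spectrum (L : {fset G}) : exists d : L -> R,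
  forall E, eigenvalue_count H L E = #|[pred i | d i <= E]|.
Proof.
have [e [d [_ _ _ ce]]] := kernel_spectrum (@sub_kernel_herm L).
by exists d => E; rewrite eigenvalue_countE ce.
Qed.

Lemma eigenvalue_count_le_card L E : (eigenvalue_count H L E <= #|` L|)%N.
Proof.
by have [d ->] := eigenvalue_count_spectrum L; rewrite cardfE max_card.
Qed.

Lemma eigenvalue_count_right L E :
  \forall E' \near E^'+, eigenvalue_count H L E' = eigenvalue_count H L E.
Proof.
have [d ce] := eigenvalue_count_spectrum L.
have : \forall E' \near E^'+, forall i : L, (d i <= E') = (d i <= E).
  apply: filter_forall => i; have [dE|Ed] := leP (d i) E.
    near=> E'; apply: (le_trans dE).
    by apply/ltW; near: E'; exact: nbhs_right_gt.
  near=> E'; apply/negbTE; rewrite -ltNge.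
  by near: E'; exact: nbhs_right_lt.
apply: filterS => E' dE; rewrite !ce; apply: eq_card => i.
by rewrite !inE dE.
Unshelve. all: by end_near. Qed.

Lemma eigenvalue_count_embed (L L' : {fset G}) (j : G -> G) E :
  {in L &, injective j} -> (forall x, x \in L -> j x \in L') ->
  {in L &, forall x y,
    matrix_element H (j x) (j y) = matrix_element H x y} ->
  (eigenvalue_count H L E <= eigenvalue_count H L' E)%N /\
  (eigenvalue_count H L' E + #|` L| <= eigenvalue_count H L E + #|` L'|)%N.
Proof.
move=> j_inj jL jH; rewrite !eigenvalue_countE !cardfE.
pose J (x : L) : L' := [` jL _ (valP x)].
apply: (level_count_embed (j := J)).
- by move=> x y /(congr1 val) /= /(j_inj _ _ (valP x) (valP y)) /val_inj.
- by move=> x y; exact: jH (valP x) (valP y).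
- exact: sub_kernel_herm.
Qed.

Lemma eigenvalue_count_subset (L L' : {fset G}) E : L `<=` L' ->
  (eigenvalue_count H L E <= eigenvalue_count H L' E)%N /\
  (eigenvalue_count H L' E + #|` L| <= eigenvalue_count H L E + #|` L'|)%N.
Proof.
move=> LL'; apply: (eigenvalue_count_embed (j := id)) => //.
exact/fsubsetP.
Qed.

(** The direct sum of the two blocks embeds in the compression to the union,
    and both inequalities of the comparison lemma become equalities because the
    cardinals agree. *)
Lemma eigenvalue_countU (L1 L2 : {fset G}) E : [disjoint L1 & L2] ->
  (forall x y, x \in L1 -> y \in L2 -> matrix_element H x y = 0) ->
  eigenvalue_count H (L1 `|` L2) E =
  (eigenvalue_count H L1 E + eigenvalue_count H L2 E)%N.
Proof.
move=> dis H0; rewrite !eigenvalue_countE.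
rewrite -level_count_sum; [|exact: sub_kernel_herm..].
have in1 (x : L1) : val x \in L1 `|` L2 by rewrite inE (valP x).
have in2 (x : L2) : val x \in L1 `|` L2 by rewrite inE (valP x) orbT.
pose J (z : L1 + L2) : L1 `|` L2 :=
  match z with inl x => [` in1 x] | inr x => [` in2 x] end.
have ne (x : L1) (y : L2) : val x <> val y.
  move=> xy; have /fdisjointP/(_ _ (valP x)) := dis.
  by rewrite xy (valP y).
have J_inj : injective J.
  case=> x; case=> y /(congr1 val) /= xy.
  - by congr inl; exact: val_inj.
  - by case: (ne x y).
  - by case: (ne y x).
  - by congr inr; exact: val_inj.
have := @level_count_embed R _ _ (sum_kernel (@sub_kernel L1) (@sub_kernel L2))
  (@sub_kernel (L1 `|` L2)) J J_inj _ E (@sub_kernel_herm _).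
rewrite card_sum -!cardfE cardfsU.
move: dis; rewrite -fsetI_eq0 => /eqP ->; rewrite cardfs0 subn0.
rewrite leq_add2r => h; apply/eqP; rewrite eqn_leq.
apply/andP; case: h => [|? ?]; last by split.
case=> x; case=> y //=; rewrite /sub_kernel /=.
- by rewrite H0 ?(valP x) ?(valP y).
- by rewrite matrix_element_herm H0 ?conjC0 ?(valP x) ?(valP y).
Qed.

Lemma eigenvalue_count_bigcup (K : choiceType) (s : seq K) (P : K -> {fset G}) E :
  uniq s ->
  {in s &, forall k k', k != k' -> [disjoint P k & P k']} ->
  {in s &, forall k k', k != k' -> forall x y, x \in P k -> y \in P k' ->
    matrix_element H x y = 0} ->
  eigenvalue_count H (\bigcup_(k <- s) P k) E =
  (\sum_(k <- s) eigenvalue_count H (P k) E)%N.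
Proof.
elim: s => [_ _ _|k s IH /= /andP[ks us] dis H0].
  rewrite !big_nil.
  by apply/eqP; rewrite -leqn0 -(cardfs0 G) eigenvalue_count_le_card.
have ne k' : k' \in s -> k != k' by apply: contraTneq => <-.
have sub k' : k' \in s -> k' \in k :: s by rewrite inE orbC => ->.
rewrite !big_cons eigenvalue_countU ?IH //.
- by move=> k1 k2 /sub ? /sub ?; exact: dis.
- by move=> k1 k2 /sub ? /sub ?; exact: H0.
- apply/fdisjointP => x xk; apply/negP => /bigfcupP[k' /andP[k's _]].
  apply/negP; have /fdisjointP := dis _ _ (mem_head k s) (sub _ k's) (ne _ k's).
  exact.
- move=> x y xk /bigfcupP[k' /andP[k's _]].
  exact: H0 (mem_head k s) (sub _ k's) (ne _ k's) _ _ xk.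
Qed.

End CompressionCount.

(** * Boundaries of finite subsets of a group *)

Section FiniteSubsets.
Variable G : groupType.
Implicit Types (g h k x y z : G) (K P Q F T : {fset G}).
Local Open Scope fset_scope.

Lemma mem_translate g Q x : (x \in translate g Q) = ((g^-1 * x)%g \in Q).
Proof.
apply/imfsetP/idP => [[y yQ ->]|gx]; first by rewrite mulKg.
by exists (g^-1 * x)%g => //; rewrite mulVKg.
Qed.

Lemma mem_set_inverse Q x : (x \in set_inverse Q) = ((x^-1)%g \in Q).
Proof.
apply/imfsetP/idP => [[y yQ ->]|xQ]; first by rewrite invgK.
by exists (x^-1)%g => //; rewrite invgK.
Qed.

Lemma card_translate g Q : #|` translate g Q| = #|` Q|.
Proof. by rewrite card_imfset //; exact: mulgI. Qed.

Lemma card_set_inverse Q : #|` set_inverse Q| = #|` Q|.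
Proof. by rewrite card_imfset //; exact: invg_inj. Qed.

Lemma big_translate (R : nmodType) g Q (f : G -> R) :
  (\sum_(x <- translate g Q) f x = \sum_(x <- Q) f (g * x)%g)%R.
Proof. by rewrite big_imfset //= => x y _ _; exact: mulgI. Qed.

Lemma count_inj Q Q' (p q : pred G) (j : G -> G) :
  injective j -> (forall x, x \in Q -> p x -> (j x \in Q') && q (j x)) ->
  (count p Q <= count q Q')%N.
Proof.
move=> j_inj jp; rewrite -!size_filter -(size_map j); apply: uniq_leq_size.
  by rewrite map_inj_uniq ?filter_uniq ?fset_uniq.
move=> _ /mapP[x + ->]; rewrite !mem_filter => /andP[px xQ].
by rewrite andbC jp.
Qed.

(** The points of Q that right translation by k moves out of Q.  Right
    translations are the relevant ones, since the word metric is left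
    invariant. *)
Definition escape Q k : nat := count (fun x => (x * k)%g \notin Q) Q.

Lemma escape_translate g Q k : (escape (translate g Q) k <= escape Q k)%N.
Proof.
apply: (count_inj (mulgI (g^-1)%g)) => x.
by rewrite !mem_translate => -> /=; rewrite mulgA.
Qed.

(** A point of the difference leaves it either by leaving Q, or by entering P;
    in the latter case the inverse translation moves the image out of P. *)
Lemma escape_setD P Q k :
  (escape (Q `\` P) k <= escape Q k + escape P (k^-1)%g)%N.
Proof.
pose p x := (x * k)%g \notin Q; pose q x := (x * k)%g \in P.
have : (escape (Q `\` P) k <= count p (Q `\` P) + count q (Q `\` P))%N.
  rewrite -count_predUI (leq_trans _ (leq_addr _ _)) //; apply: sub_count => x.
  by rewrite /p /q inE negb_and negbK /= orbC.
move=> /leq_trans; apply; apply: leq_add.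
  apply: (@count_inj _ _ _ _ id) => // x.
  by rewrite inE => /andP[_ ->].
apply: (count_inj (mulIg k)) => x.
by rewrite inE /q => /andP[xP _] ->; rewrite mulgK.
Qed.

(** The points whose K-neighborhood stays inside.  With K a word ball this is
    the interior that carries the compression; with K an inverse tile it is the
    set of the centers of the tiles contained in Q. *)
Definition deep K Q : {fset G} := [fset x in Q | all (fun k => (x * k)%g \in Q) K].

Lemma deepP K Q x :
  reflect (x \in Q /\ forall k, k \in K -> (x * k)%g \in Q) (x \in deep K Q).
Proof. by rewrite !inE; apply: (iffP andP) => -[h1 /allP h2]. Qed.

Lemma deep_sub K Q : deep K Q `<=` Q.
Proof. by apply/fsubsetP => x /deepP[]. Qed.

Lemma card_setD_deep K Q :
  (#|` Q `\` deep K Q| <= \sum_(k <- K) escape Q k)%N.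
Proof.
rewrite -sum1_size.
apply: (@leq_trans (\sum_(x <- Q `\` deep K Q) \sum_(k <- K) ((x * k)%g \notin Q)%N)).
  rewrite big_seq [leqRHS]big_seq; apply: leq_sum => x; rewrite inE => /andP[xD xQ].
  have : ~~ all (fun k => (x * k)%g \in Q) K.
    by apply: contra xD => /allP xK; apply/deepP.
  by move=> /allPn[k kK xk]; rewrite (big_rem k) //= xk.
apply: (@leq_trans (\sum_(x <- Q) \sum_(k <- K) ((x * k)%g \notin Q)%N)).
  rewrite [leqRHS](big_fsetID _ (mem (deep K Q))) /=.
  rewrite (_ : [fset x in Q | x \notin deep K Q] = Q `\` deep K Q) ?leq_addl //.
  by apply/fsetP => x; rewrite [LHS]in_fset [RHS]in_fsetD andbC.
rewrite exchange_big /=; apply: leq_sum => k _.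
by rewrite /escape -sum1_count [leqRHS]big_mkcond; apply: leq_sum => x _; case: ifP.
Qed.

(** Inversion turns the left Folner condition on T into a right one. *)
Lemma escape_set_inverse_le T k :
  (escape (set_inverse T) k <= #|` symdiff T (set_product [fset k] T)|)%N.
Proof.
rewrite /symdiff -count_predT; apply: (count_inj invg_inj) => x.
rewrite !mem_set_inverse invgM => xT kxT; rewrite andbT !inE xT andbT.
apply/orP; left; apply/negP => /imfset2P[k' + [y yT e]].
rewrite inE => /eqP kE; move: kxT; rewrite e kE mulKg.
by rewrite yT.
Qed.

End FiniteSubsets.

Section Averages.
Variables (R : realType) (G : groupType).
Implicit Types (P Q F : {fset G}) (f : G -> R).
Local Open Scope fset_scope.
Local Open Scope ring_scope.

Lemma sum_fsubset f P Q : P `<=` Q ->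
  \sum_(x <- Q) f x = \sum_(x <- P) f x + \sum_(x <- Q `\` P) f x.
Proof.
move=> PQ; rewrite (big_fsetID _ (mem P)) /=; congr (_ + _).
  by apply: eq_fbigl => x; rewrite !inE /= andbC; have [/(fsubsetP PQ)|] := boolP (x \in P).
by apply: eq_fbigl => x; rewrite !inE /= andbC.
Qed.

Lemma sum_shift_le f Q z : (forall x, 0 <= f x <= 1) ->
  \sum_(x <- Q) f x <= \sum_(x <- Q) f (x * z)%g + (escape Q (z^-1)%g)%:R.
Proof.
move=> f01; rewrite (bigID (fun x => (x * z^-1)%g \in Q)) /=; apply: lerD.
  rewrite -big_filter.
  pose Q1 := [fset x in Q | (x * z^-1)%g \in Q].
  pose Qz := [fset (x * z)%g | x in Q].
  have -> : \sum_(x <- Q) f (x * z)%g = \sum_(x <- Qz) f x.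
    by rewrite big_imfset //= => x y _ _; exact: mulIg.
  rewrite (@sum_fsubset _ Q1 Qz); last first.
    apply/fsubsetP => x; rewrite !inE => /andP[_ xz].
    by apply/imfsetP; exists (x * z^-1)%g => //; rewrite mulgVK.
  rewrite big_filter -[leLHS]addr0; apply: lerD; last first.
    by apply: sumr_ge0 => x _; case/andP: (f01 x).
  rewrite le_eqVlt; apply/orP; left; apply/eqP.
  by rewrite -big_filter; apply: perm_big; apply: uniq_perm;
    rewrite ?filter_uniq ?fset_uniq // => x; rewrite mem_filter !inE andbC.
rewrite /escape -sum1_count natr_sum; apply: ler_sum => x _.
by case/andP: (f01 x).
Qed.

(** Compare the sums of f over Q and over its translates Qz, and average over z
    in F: each translation costs at most the number of points that leave Q. *)
Lemma sum_le_by_averages f Q F (s : R) : (forall x, 0 <= f x <= 1) ->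
  (forall g, \sum_(z <- F) f (g * z)%g <= s * #|` F|%:R) ->
  #|` F|%:R * \sum_(x <- Q) f x <=
    #|` F|%:R * (#|` Q|%:R * s) + \sum_(z <- F) (escape Q (z^-1)%g)%:R.
Proof.
move=> f01 fs.
have cardE (A : {fset G}) (c : R) : \sum_(x <- A) c = #|` A|%:R * c.
  by rewrite big_const_seq count_predT iter_addr addr0 mulr_natl.
rewrite -cardE.
apply: (le_trans (ler_sum _ (fun z _ => sum_shift_le Q z f01))).
rewrite big_split lerD2r exchange_big /=.
apply: (le_trans (ler_sum _ (fun x _ => fs x))).
by rewrite cardE mulrA [leRHS]mulrC.
Qed.

End Averages.

(** * Convergence of averages of local functions *)

(** Tempered repetitivity in terms of F_m = T_m^-1: every patch of shape F_m
    reappears in every translate of some F_n that is at most 1/c times as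
    large. *)
Definition repetitive_sequence (R : realType) (G : groupType) (A : finType)
    (C : G -> A) (F : nat -> {fset G}) (c : R) :=
  forall m, exists2 n, c * #|` F n|%:R <= #|` F m|%:R &
    forall g0 g, exists2 y,
      (forall s, s \in F m -> (g^-1 * (y * s))%g \in F n) &
      (forall s, s \in F m -> C (y * s)%g = C (g0 * s)%g).

Section EventualBounds.
Variable R : realType.

Lemma near_all (T : eqType) (P : T -> nat -> Prop) (s : seq T) :
  (forall x, \forall m \near \oo, P x m) ->
  \forall m \near \oo, forall x, x \in s -> P x m.
Proof.
move=> hP; elim: s => [|y s IH]; first exact: nearW.
near=> m => x; rewrite inE => /orP[/eqP ->|]; first by near: m.
by move: x; near: m.
Unshelve. all: by end_near. Qed.

Lemma near_sum_le (T : eqType) (u : T -> nat -> R) (v : nat -> R) (s : seq T) :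
  (forall m, 0 <= v m) ->
  (forall x eps, 0 < eps -> \forall m \near \oo, u x m <= eps * v m) ->
  forall eps, 0 < eps -> \forall m \near \oo, \sum_(x <- s) u x m <= eps * v m.
Proof.
move=> v0 uv eps e0; have e1 : 0 < eps / (size s).+1%:R by rewrite divr_gt0.
have := near_all s (fun x => uv x _ e1); apply: filterS => m um.
have -> : eps * v m = \sum_(x <- s) (eps / (size s).+1%:R * v m) +
    eps / (size s).+1%:R * v m.
  rewrite big_const_seq count_predT iter_addr addr0 -mulrSr -[RHS]mulr_natl.
  by rewrite mulrA (mulrC _ (eps / _)) divfK ?pnatr_eq0.
rewrite -[leLHS]addr0; apply: lerD; last by rewrite mulr_ge0 // ltW.
by rewrite big_seq [leRHS]big_seq; apply: ler_sum => x; exact: um.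
Qed.

End EventualBounds.

Section Frequencies.
Variables (R : realType) (G : groupType) (F : nat -> {fset G}).
Local Open Scope fset_scope.
Local Open Scope ring_scope.
Hypothesis F_gt0 : forall m, (0 < #|` F m|)%N.
Hypothesis F_mono : forall m n, (n <= m)%N -> F n `<=` F m.
Hypothesis F_folner : forall k (eps : R), 0 < eps ->
  \forall m \near \oo, (escape (F m) k)%:R <= eps * #|` F m|%:R.

Lemma near_sum_escape (s : seq G) (eps : R) : 0 < eps ->
  \forall m \near \oo,
    \sum_(z <- s) (escape (F m) z)%:R <= eps * #|` F m|%:R.
Proof.
move=> e0; apply: (near_sum_le (u := fun z m => (escape (F m) z)%:R)) e0 => // z d d0; exact: F_folner.
Qed.

Section OneFunction.
Variable f : G -> R.
Hypothesis f01 : forall x, 0 <= f x <= 1.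

Definition uniform_upper_bounds : set R :=
  [set u | exists k, forall g,
    \sum_(z <- F k) f (g * z)%g <= u * #|` F k|%:R].

Definition upper_mean : R := inf uniform_upper_bounds.

Lemma uniform_upper_bounds_has_inf : has_inf uniform_upper_bounds.
Proof.
have F0 : (0 : R) < #|` F 0|%:R by rewrite ltr0n.
split.
  exists 1, 0%N => g; rewrite mul1r -sum1_size natr_sum; apply: ler_sum => z _.
  by case/andP: (f01 (g * z)%g).
exists 0 => u [k /(_ 1%g)]; have Fk : (0 : R) < #|` F k|%:R by rewrite ltr0n.
move=> h; rewrite -(pmulr_lge0 _ Fk); apply: le_trans h.
by apply: sumr_ge0 => z _; case/andP: (f01 (1 * z)%g).
Qed.

Lemma upper_mean_lt eps : 0 < eps -> exists k, forall g,
  \sum_(z <- F k) f (g * z)%g <= (upper_mean + eps) * #|` F k|%:R.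
Proof.
move=> e0; have [u [k uk] ue] := inf_adherent e0 uniform_upper_bounds_has_inf.
by exists k => g; apply: (le_trans (uk g)); rewrite ler_wpM2r // ltW.
Qed.

Lemma upper_mean_gt k eps : 0 < eps -> exists g,
  (upper_mean - eps) * #|` F k|%:R < \sum_(z <- F k) f (g * z)%g.
Proof.
move=> e0; apply: contrapT => h.
have : upper_mean <= upper_mean - eps.
  apply: ge_inf; first by case: uniform_upper_bounds_has_inf.
  by exists k => g; rewrite leNgt; apply/negP => lt; apply: h; exists g.
by rewrite lerBrDr gerDl leNgt e0.
Qed.

(** An average over g F_m is, up to boundary terms, an average of averages over
    translates of F_k. *)
Lemma near_upper_mean eps : 0 < eps -> \forall m \near \oo, forall g,
  \sum_(z <- F m) f (g * z)%g <= (upper_mean + eps) * #|` F m|%:R.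
Proof.
move=> e0; have e2 : 0 < eps / 2 by rewrite divr_gt0.
have [k uk] := upper_mean_lt e2.
have := near_sum_escape [seq (z^-1)%g | z <- F k] e2.
apply: filterS => m esc g.
have fg01 x : 0 <= f (g * x)%g <= 1 by exact: f01.
have ug h : \sum_(z <- F k) f (g * (h * z))%g <= (upper_mean + eps / 2) * #|` F k|%:R.
  by have := uk (g * h)%g; under eq_bigr do rewrite -mulgA.
have := sum_le_by_averages (F m) fg01 ug.
have Fk : (0 : R) < #|` F k|%:R by rewrite ltr0n.
rewrite big_map in esc.
move=> h; rewrite -(ler_pM2l Fk); apply: (le_trans h).
apply: (le_trans (lerD (lexx _) esc)).
have : 0 <= (#|` F k|%:R - 1) * (eps / 2 * #|` F m|%:R).
  apply: mulr_ge0; last by rewrite mulr_ge0 // ltW.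
  by rewrite subr_ge0 ler1n; exact: F_gt0.
lra.
Qed.

End OneFunction.

Variables (A : finType) (C : G -> A) (c : R).
Hypothesis c_gt0 : 0 < c.
Hypothesis F_rep : repetitive_sequence C F c.

Section LocalFunction.
Variables (f : G -> R) (F0 : {fset G}).
Hypothesis f01 : forall x, 0 <= f x <= 1.
Hypothesis f_local : forall g h : G,
  (forall x, x \in F0 -> C (g * x)%g = C (h * x)%g) -> f g = f h.

Let f' x := 1 - f x.

Let f'01 x : 0 <= f' x <= 1.
Proof. by rewrite /f' subr_ge0 gerBl andbC f01. Qed.

(** Equal patches on Q give equal values of f except at the points of Q whose
    F0-neighborhood is not contained in Q. *)
Lemma patch_sum_le (Q : {fset G}) y g : (forall s, s \in Q -> C (y * s)%g = C (g * s)%g) ->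
  \sum_(x <- Q) f (y * x)%g <=
    \sum_(x <- Q) f (g * x)%g + \sum_(z <- F0) (escape Q z)%:R.
Proof.
move=> yg.
pose b x := has (fun z => (x * z)%g \notin Q) F0.
apply: (@le_trans _ _ (\sum_(x <- Q) (f (g * x)%g + (b x)%:R))).
  rewrite big_seq [leRHS]big_seq; apply: ler_sum => x xQ.
  case: (boolP (b x)) => [_|/hasPn nb].
    case/andP: (f01 (y * x)%g) => _ h1; case/andP: (f01 (g * x)%g) => h2 _.
    by rewrite -[leLHS]add0r lerD.
  rewrite addr0 (f_local (h := (g * x)%g)) // => z zF0.
  by rewrite -!mulgA; apply: yg; have := nb z zF0; rewrite negbK.
rewrite big_split lerD2l /= /escape.
under [leRHS]eq_bigr do rewrite -sum1_count natr_sum big_mkcond /=.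
rewrite exchange_big /=; apply: ler_sum => x _.
case: (boolP (b x)) => [/hasP[z zF0 xz]|_]; last first.
  by apply: sumr_ge0 => z _; case: ifP.
rewrite (big_rem z) //= xz lerDl; apply: sumr_ge0 => z' _.
by case: ifP.
Qed.

(** If F_n contains a copy of F_m while n < m, then F_n = F_m by monotonicity,
    and m can be used in place of n. *)
Lemma repetitive_sequence_ge m : exists n,
  [/\ (m <= n)%N, c * #|` F n|%:R <= #|` F m|%:R &
    forall g0 g, exists2 y,
      (forall s, s \in F m -> (g^-1 * (y * s))%g \in F n) &
      (forall s, s \in F m -> C (y * s)%g = C (g0 * s)%g)].
Proof.
have [n cn rep] := F_rep m; have [mn|nm] := leqP m n; first by exists n.
suff e : F n = F m.
  exists m; split => //; first by rewrite -{1}e.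
  move=> g0 g; have [y yF yC] := rep g0 g; exists y => // s sF.
  by rewrite -{1}e; exact: yF.
apply/eqP; rewrite eqEfcard (F_mono (ltnW nm)) /=.
have [y yF _] := rep 1%g 1%g; rewrite -(card_translate y (F m)).
apply: fsubset_leq_card; apply/fsubsetP => x; rewrite mem_translate => /yF.
by rewrite invg1 mul1g mulVKg.
Qed.

(** A translate of F_n with almost maximal average contains a copy of a patch
    of shape F_m with almost minimal average.  The copy takes up a proportion at
    least c, and the complement of the copy is again almost invariant, so its
    average is at most [upper_mean f + eps].  If the maximal and the minimal
    average differed by a fixed amount, the whole average would be too small. *)
Lemma upper_mean_complement : upper_mean f + upper_mean f' <= 1.
Proof.
rewrite leNgt; apply/negP => gt1.
pose D := upper_mean f + upper_mean f' - 1.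
have D0 : 0 < D by rewrite subr_gt0.
(* The error terms add up to less than 5 eps |F_n|, and c |F_n| <= |F_m|. *)
pose eps := c * D / 12.
have e0 : 0 < eps by rewrite divr_gt0 // mulr_gt0.
have [k uk] := upper_mean_lt f01 e0.
(* Both F_k and its inverse occur: the complement of the copy of F_m can be
   left through its outer or through its inner boundary. *)
have [m [esc0 esc1 esc2]] : exists m,
   [/\ \sum_(z <- F0) (escape (F m) z)%:R <= eps * #|` F m|%:R,
      \sum_(z <- F k) (escape (F m) z)%:R <= eps * #|` F m|%:R &
      forall n, (m <= n)%N -> \sum_(z <- [seq (z^-1)%g | z <- F k])
         (escape (F n) z)%:R <= eps * #|` F n|%:R].
  have [m1 _ h1] := near_sum_escape F0 e0.
  have [m2 _ h2] := near_sum_escape (F k) e0.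
  have [m3 _ h3] := near_sum_escape [seq (z^-1)%g | z <- F k] e0.
  exists (maxn m1 (maxn m2 m3)); split.
  - by apply: h1; rewrite /= leq_maxl.
  - by apply: h2; rewrite /= !leq_max leqnn !orbT.
  - by move=> n; rewrite !geq_max => /and3P[_ _ ?]; apply: h3.
have [n [mn cn rep]] := repetitive_sequence_ge m.
have [g hg] := upper_mean_gt f01 n e0.
have [g0 hg0] := upper_mean_gt f'01 m e0.
have [y yF yC] := rep g0 g.

pose P := translate (g^-1 * y)%g (F m).
have PF : P `<=` F n.
  by apply/fsubsetP => x; rewrite mem_translate => /yF; rewrite mulgA mulVKg.
have := hg; rewrite (sum_fsubset _ PF) big_translate.
under eq_bigr do rewrite mulgA mulVKg.
have := patch_sum_le yC.
have fg01 x : 0 <= f (g * x)%g <= 1 by exact: f01.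
have ug h : \sum_(z <- F k) f (g * (h * z))%g <= (upper_mean f + eps) * #|` F k|%:R.
  by have := uk (g * h)%g; under eq_bigr do rewrite -mulgA.
have := sum_le_by_averages (F n `\` P) fg01 ug.
have escP : \sum_(z <- F k) (escape (F n `\` P) (z^-1)%g)%:R <=
    eps * #|` F n|%:R + eps * #|` F m|%:R.
  have := esc2 n mn; rewrite big_map => h.
  apply: le_trans (lerD h esc1); rewrite -big_split /=; apply: ler_sum => z _.
  rewrite -natrD ler_nat (leq_trans (escape_setD _ _ _)) // invgK.
  by rewrite leq_add2l escape_translate.
rewrite cardfsDS // card_translate natrB; last first.
  by rewrite -(card_translate (g^-1 * y)%g (F m)) fsubset_leq_card.
move: hg0; rewrite /f' big_split /= sumrN big_const_seq count_predT.
rewrite iter_addr addr0.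
have Fk1 : (1 : R) <= #|` F k|%:R by rewrite ler1n; exact: F_gt0.
have Fm0 : (0 : R) < #|` F m|%:R by rewrite ltr0n.
have Fmn : (#|` F m|%:R : R) <= #|` F n|%:R by rewrite ler_nat fsubset_leq_card ?F_mono.
move: escP esc0 cn Fk1 Fm0 Fmn.
move: (\sum_(x <- _) f (y * x)%g) (\sum_(x <- F m) f (g0 * x)%g).
move: (\sum_(x <- _) f (g * x)%g) (#|` F k|%:R : R).
move: (\sum_(z <- F k) _) (\sum_(z <- F0) _).
move: (#|` F m|%:R : R) (#|` F n|%:R : R).
move=> a b Z E0 X K Y S0 escP esc0 cn K1 a0 ab hS hX hY hg'.
have De : 12 * eps = c * D by rewrite /eps mulrC divfK // pnatr_eq0.
have X1 : X <= (b - a) * (upper_mean f + eps) + eps * (b + a).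
  rewrite -(ler_pM2l (lt_le_trans ltr01 K1)).
  have : 0 <= (K - 1) * (eps * (b + a)) by rewrite mulr_ge0 ?subr_ge0 // mulr_ge0 ?ltW // addr_gt0 // (lt_le_trans a0).
  lra.
have D1 : D * a < 5 * eps * b.
  have : 0 <= eps * (b - a) by rewrite mulr_ge0 ?subr_ge0 // ltW.
  rewrite /D; lra.
have D2 : 12 * eps * b <= D * a by rewrite De -mulrA mulrCA ler_pM2l.
have : 0 < eps * b by rewrite mulr_gt0 // (lt_le_trans a0).
lra.
Qed.

End LocalFunction.

Lemma local_average_cvg (f : G -> R) (F0 : {fset G}) :
  (forall x, 0 <= f x <= 1) ->
  (forall g h : G, (forall x, x \in F0 -> C (g * x)%g = C (h * x)%g) ->
    f g = f h) ->
  exists M, forall eps, 0 < eps -> \forall m \near \oo,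
    `|\sum_(x <- F m) f x - M * #|` F m|%:R| <= eps * #|` F m|%:R.
Proof.
move=> f01 f_local.
have f'01 x : 0 <= 1 - f x <= 1 by rewrite subr_ge0 gerBl andbC f01.
exists (upper_mean f) => eps e0.
have := near_upper_mean f01 e0.
have := near_upper_mean f'01 e0.
apply: filterS2 => m /(_ 1%g) h1 /(_ 1%g) h2; move: h1 h2 => /=.
have mul1 (u : G -> R) : \sum_(z <- F m) u (1 * z)%g = \sum_(z <- F m) u z.
  by apply: eq_bigr => z _; rewrite mul1g.
rewrite (mul1 f) (mul1 (fun x => 1 - f x)).
rewrite big_split /= sumrN big_const_seq count_predT iter_addr addr0.
have Fm0 : (0 : R) <= #|` F m|%:R by [].
have := ler_wpM2r Fm0 (upper_mean_complement f01 f_local).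
rewrite ler_norml => h1 h2 h3; apply/andP; split; lra.
Qed.

End Frequencies.

(** * Random orders *)

(** Left translation by a group element is only a partial injection of a
    finite set of labels, but it agrees with a permutation where it is
    defined. *)
Lemma perm_extending (W : finType) (V : {set W}) (f : W -> W) :
  {in V &, injective f} -> exists s : {perm W}, {in V, s =1 f}.
Proof.
move: {2}#|V| (leqnn #|V|) => n; elim: n V => [|n IH] V.
  by rewrite leqn0 cards_eq0 => /eqP -> _; exists 1%g => x; rewrite inE.
have [->|[v vV]] := set_0Vmem V; first by exists 1%g => x; rewrite inE.
rewrite (cardsD1 v) vV => Vn f_inj.
have [|s sf] := IH (V :\ v)%SET Vn.
  move=> x y; rewrite !inE => /andP[_ xV] /andP[_ yV]; exact: f_inj.
exists (s * tperm (s v) (f v))%g => u uV; rewrite permM.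
have [->|uv] := eqVneq u v; first by rewrite tpermL.
have uV' : u \in (V :\ v)%SET by rewrite !inE uv.
rewrite tpermD.
- exact: sf.
- by rewrite (inj_eq perm_inj) eq_sym.
- rewrite sf //; apply: contra uv => /eqP fuv; apply/eqP.
  exact/esym/f_inj.
Qed.

Section RandomOrder.
Variables (G : groupType) (W : {fset G}).
Implicit Types (p : {perm W}) (g x : G) (D U : {fset G}).
Local Open Scope fset_scope.

(** The permutation p encodes a linear order on W through an enumeration of W;
    elements outside W have the default label 0. *)
Definition label p g : nat := if insub g is Some u then enum_rank (p u) else 0%N.

Lemma labelE p g (gW : g \in W) : label p g = enum_rank (p [` gW]).
Proof. by rewrite /label insubT. Qed.

Lemma label_inj p : {in W &, injective (label p)}.
Proof.
move=> x y xW yW; rewrite !labelE => /val_inj /enum_rank_inj /perm_inj.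
by move=> /(congr1 val).
Qed.

Lemma exists_min_label p U : U != fset0 -> 
  exists2 d, d \in U & forall w, w \in U -> (label p d <= label p w)%N.
Proof.
move=> /fset0Pn[u uU].
case: (@arg_minnP U [` uU] predT (fun v => label p (val v)) isT) => d _ dmin.
by exists (val d); rewrite ?(valP d) // => w wU; exact: (dmin [` wU]).
Qed.

Definition has_min_in p D U :=
  [exists d : D, [forall w : U, (label p (val d) <= label p (val w))%N]].

Lemma has_min_inP p D U : reflect
  (exists2 d, d \in D & forall w, w \in U -> (label p d <= label p w)%N)
  (has_min_in p D U).
Proof.
apply: (iffP existsP) => [[d /forallP h]|[d dD h]].
  by exists (val d); rewrite ?(valP d) // => w wU; exact: (h [` wU]).
by exists [` dD]; apply/forallP => w; apply: h; exact: valP.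
Qed.

(** Composing p with a transposition of u and v moves the minimum on U from
    one to the other. *)
Lemma card_min_at U u v : U `<=` W -> u \in U -> v \in U ->
  #|[pred p | has_min_in p [fset u] U]| = #|[pred p | has_min_in p [fset v] U]|.
Proof.
move=> UW uU vU.
have uW := fsubsetP UW _ uU; have vW := fsubsetP UW _ vU.
suff h (x y : G) (xU : x \in U) (yU : y \in U) (xW : x \in W) (yW : y \in W) :
   (#|[pred p | has_min_in p [fset x] U]| <=
    #|[pred p | has_min_in p [fset y] U]|)%N.
  by apply/eqP; rewrite eqn_leq !h.
(* It suffices to inject the orders with minimum x into those with minimum y. *)
pose t : {perm W} := tperm [` xW] [` yW].
rewrite -(fintype.card_image (mulgI t)); apply: fintype.subset_leq_card.
apply/fintype.subsetP => q /fintype.imageP[p pm ->]; move: pm.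
rewrite !inE.
have lab w (wW : w \in W) : label (t * p)%g w = label p (val (t [` wW])).
  by rewrite (labelE _ wW) permM (labelE _ (valP (t [` wW]))) fsetsubE.
move=> /has_min_inP[d]; rewrite inE => /eqP -> xmin.
apply/has_min_inP; exists y; first by rewrite inE.
move=> w wU; have wW := fsubsetP UW _ wU.
rewrite !lab tpermR /=; apply: xmin.
by rewrite /t; case: tpermP => //= _; rewrite ?xU ?yU.
Qed.

(** The minimum of U in a random order is uniformly distributed on U, so it
    lies in D with probability |D| / |U|. *)
Lemma card_has_min_in D U : D `<=` U -> U `<=` W ->
  (#|` U| * #|[pred p | has_min_in p D U]| <= #|` D| * #|{perm W}|)%N.
Proof.
move=> DU UW.
have at_u u : u \in U ->
    (#|` U| * #|[pred p | has_min_in p [fset u] U]| <= #|{perm W}|)%N.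
  move=> uU.
  have -> : (#|` U| * #|[pred p | has_min_in p [fset u] U]| =
      \sum_(v : U) #|[pred p | has_min_in p [fset (val v)] U]|)%N.
    rewrite cardfE -sum_nat_const; apply: eq_bigr => v _.
    by apply: card_min_at => //; exact: valP.
  under eq_bigr do rewrite -sum1_card big_mkcond /=.
  rewrite exchange_big /= -sum1_card; apply: leq_sum => p _.
  rewrite -big_mkcond sum1_card; apply/card_le1_eqP => x y.
  move=> /has_min_inP[d +] dmin /has_min_inP[d' +] dmin'.
  rewrite !inE => /eqP dE /eqP dE'; subst d d'.
  apply: val_inj; apply: (@label_inj p); rewrite ?(fsubsetP UW) ?(valP x) ?(valP y) //.
  by apply/eqP; rewrite eqn_leq dmin ?dmin' ?(valP x) ?(valP y).
apply: (@leq_trans (\sum_(d : D) (#|` U| * #|[pred p | has_min_in p [fset (val d)] U]|))).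
  rewrite -big_distrr leq_mul2l /=; apply/orP; right.
  rewrite -sum1_card big_mkcond /=.
  under [leqRHS]eq_bigr do rewrite -sum1_card big_mkcond /=.
  rewrite exchange_big /=; apply: leq_sum => p _; rewrite inE.
  case: (boolP (has_min_in p D U)) => // /has_min_inP[d dD dmin].
  rewrite (bigD1 [` dD]) //= inE ifT //.
  by apply/has_min_inP; exists d; rewrite ?inE.
apply: (@leq_trans (\sum_(d : D) #|{perm W}|)).
  by apply: leq_sum => d _; exact: at_u (fsubsetP DU _ (valP d)).
by rewrite sum_nat_const cardfE.
Qed.

End RandomOrder.

(** * Random partitions into pieces of tiles *)

Section RandomPartition.
Variables (G : groupType) (W T0 : {fset G}).
Implicit Types (p : {perm W}) (g x : G) (Q D U : {fset G}).
Local Open Scope fset_scope.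
Hypothesis T0_1 : 1%g \in T0.

(** The fiber over g of the map that sends x to the least element of x T0; it
    lies in g T0^-1. *)
Definition piece p g : {fset G} :=
  [fset x in translate g (set_inverse T0) |
    all (fun t => (label p g <= label p (x * t)%g)%N) T0].

Lemma pieceP p g x : reflect
  ((x^-1 * g)%g \in T0 /\ forall t, t \in T0 -> (label p g <= label p (x * t)%g)%N)
  (x \in piece p g).
Proof.
rewrite !inE mem_translate mem_set_inverse invgM invgK.
by apply: (iffP andP) => -[h1 /allP h2].
Qed.

Lemma piece_inj p g g' x : (forall t, t \in T0 -> (x * t)%g \in W) ->
  x \in piece p g -> x \in piece p g' -> g = g'.
Proof.
move=> xW /pieceP[gT gmin] /pieceP[g'T g'min].
have gW : g \in W by have := xW _ gT; rewrite mulVKg.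
have g'W : g' \in W by have := xW _ g'T; rewrite mulVKg.
apply: (label_inj (p := p)) => //; apply/eqP; rewrite eqn_leq.
by have := gmin _ g'T; have := g'min _ gT; rewrite !mulVKg => -> ->.
Qed.

Section Transport.
Variables (A : finType) (C : G -> A) (b : {fset G} -> nat).
Hypothesis b_local : forall g Q, (forall s, s \in Q -> C (g * s)%g = C s) ->
  b (translate g Q) = b Q.

(** All labels that decide which points belong to the piece of g are in W. *)
Definition labelled_around g := forall x t, x \in set_inverse T0 -> t \in T0 ->
  (g * (x * t))%g \in W.

(** Let h = g' g^-1 and let s be a permutation of W that extends left
    translation by h near g.  The piece of g' for the order p is the h-translate
    of the piece of g for the order s p, and p |-> s p preserves the uniform
    distribution. *)
Lemma sum_piece_pattern g g' : labelled_around g -> labelled_around g' ->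
  (forall x, x \in set_inverse T0 -> C (g * x)%g = C (g' * x)%g) ->
  (\sum_p b (piece p g) = \sum_p b (piece p g'))%N.
Proof.
move=> gW g'W gg'.
have F1 : 1%g \in set_inverse T0 by rewrite mem_set_inverse invg1.
pose h := (g' * g^-1)%g.
pose V : {set W} :=
  finset (fun w : W => (g^-1 * val w)%g \in set_product (set_inverse T0) T0).
pose f (w : W) : W := insubd w (h * val w)%g.
have fE w : w \in V -> val (f w) = (h * val w)%g.
  rewrite inE => /imfset2P[x xF [t tT e]]; rewrite /f val_insubd ifT //.
  have -> : (h * val w = g' * (g^-1 * val w))%g by rewrite /h mulgA.
  by rewrite e g'W.
have [|s sf] := @perm_extending W V f.
  move=> u v uV vV /(congr1 val); rewrite !fE // => /mulgI; exact: val_inj.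
have lab p x t : x \in set_inverse T0 -> t \in T0 ->
    label p (g' * (x * t))%g = label (s * p)%g (g * (x * t))%g.
  move=> xF tT; rewrite (labelE _ (gW _ _ xF tT)) (labelE _ (g'W _ _ xF tT)).
  rewrite permM; do 3 f_equal; apply: val_inj.
  have wV : [` gW _ _ xF tT] \in V.
    rewrite inE /= mulKg; apply/imfset2P; exists x => //; by exists t.
  by rewrite sf // fE //= /h -mulgA mulKg.
have lab1 p : label p g' = label (s * p)%g g.
  by have := lab p _ _ F1 T0_1; rewrite mulg1 !mulg1.
rewrite (reindex_inj (mulgI s)) /=; apply: eq_bigr => p _.
suff -> : piece p g' = translate h (piece (s * p)%g g).
  apply/esym/b_local => y /pieceP[yT _].
  have yF : (g^-1 * y)%g \in set_inverse T0 by rewrite mem_set_inverse invgM invgK.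
  by have := gg' _ yF; rewrite mulVKg /h -mulgA => ->.
apply/fsetP => y; rewrite mem_translate; apply/pieceP/pieceP.
  move=> [yT ymin]; have yE : ((h^-1 * y)^-1 * g = y^-1 * g')%g.
    by rewrite invgM invgK -mulgA /h mulgVK.
  split; first by rewrite yE.
  move=> t tT; have xF : (g'^-1 * y)%g \in set_inverse T0 by rewrite mem_set_inverse invgM invgK.
  have -> : (h^-1 * y * t = g * (g'^-1 * y * t))%g by rewrite /h invgM invgK !mulgA.
  by rewrite -lab // -lab1 -[(_ * y * t)%g]mulgA mulVKg ymin.
move=> [yT ymin]; have yE : ((h^-1 * y)^-1 * g = y^-1 * g')%g.
  by rewrite invgM invgK -mulgA /h mulgVK.
rewrite yE in yT; split => // t tT.
have xF : (g'^-1 * y)%g \in set_inverse T0 by rewrite mem_set_inverse invgM invgK.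
have := ymin t tT.
have -> : (h^-1 * y * t = g * (g'^-1 * y * t))%g by rewrite /h invgM invgK !mulgA.
by rewrite -lab // -lab1 -[(_ * y * t)%g]mulgA mulVKg.
Qed.

End Transport.

Section Boundary.
Variables (Q K : {fset G}).
Hypothesis QW : forall x t, x \in Q -> t \in T0 -> (x * t)%g \in W.

(** A point that is not moved out of Q by this set has its whole piece, and
    its K-neighborhood, inside Q. *)
Definition exit_set : {fset G} :=
  K `|` set_product T0 (set_inverse T0).

(** An event implied by x and xk lying in different pieces: if the least
    element of the union of both translates of T0 belongs to each of them, then
    it is the least element of each. *)
Definition split_at p x k : bool :=
  has_min_in p (symdiff (translate x T0) (translate (x * k)%g T0))
    (translate x T0 `|` translate (x * k)%g T0).

Lemma split_or_exit p x : x \in Q ->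
  (forall g, g \in deep (set_inverse T0) Q -> x \notin deep K (piece p g)) ->
  (exists2 k, k \in exit_set & (x * k)%g \notin Q) \/
  (exists2 k, k \in K & (x * k)%g \in Q /\ split_at p x k).
Proof.
move=> xQ xdeep.
case: (boolP (all (fun k => (x * k)%g \in Q) exit_set)) => [/allP stay|]; last first.
  by move=> /allPn[k kK kQ]; left; exists k.
right.
have T0n : translate x T0 != fset0.
  by apply/fset0Pn; exists x; rewrite mem_translate mulVg.
have [g gT gmin] := exists_min_label p T0n; rewrite mem_translate in gT.
have xg : x \in piece p g.
  by apply/pieceP; split => // t tT; apply: gmin; rewrite mem_translate mulKg.
have gQ z : z \in set_inverse T0 -> (g * z)%g \in Q.
  move=> zF; have := stay (x^-1 * g * z)%g.
  rewrite -[(_ * g * z)%g]mulgA mulVKg; apply; rewrite inE; apply/orP; right.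
  by apply/imfset2P; exists (x^-1 * g)%g => //; exists z => //; rewrite mulgA.
have gI : g \in deep (set_inverse T0) Q.
  apply/deepP; split=> //.
  by have := gQ 1%g; rewrite mulg1; apply; rewrite mem_set_inverse invg1.
case: (boolP (all (fun k => (x * k)%g \in piece p g) K)).
  by move=> /allP xK; case/negP: (xdeep g gI); apply/deepP.
move=> /allPn[k kK xkg]; exists k => //.
have xkQ : (x * k)%g \in Q by apply: stay; rewrite inE kK.
split => //; apply/has_min_inP.
have Un : translate x T0 `|` translate (x * k)%g T0 != fset0.
  by apply/fset0Pn; exists g; rewrite inE !mem_translate gT.
have [d dU dmin] := exists_min_label p Un; exists d => //.
rewrite /symdiff !inE; move: dU; rewrite inE.
case: (boolP (d \in translate x T0)) => dx; last by rewrite /= => ->.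
move=> _; case: (boolP (d \in translate (x * k)%g T0)) => // dxk /=.
case/negP: xkg.
have xW t : t \in T0 -> (x * t)%g \in W by exact: QW.
have xd : x \in piece p d.
  rewrite mem_translate in dx; apply/pieceP; split => // t tT.
  by apply: dmin; rewrite inE !mem_translate mulKg tT.
rewrite (piece_inj xW xg xd); apply/pieceP; rewrite mem_translate in dxk.
split => // t tT; apply: dmin.
by rewrite inE !mem_translate mulKg tT orbT.
Qed.

Definition uncovered p : nat :=
  count (fun x => ~~ has (fun g => x \in deep K (piece p g)) (deep (set_inverse T0) Q)) Q.

Lemma card_symdiff_translate x k :
  #|` symdiff (translate x T0) (translate (x * k)%g T0)| =
  #|` symdiff T0 (set_product [fset k] T0)|.
Proof.
rewrite -[RHS](card_translate x); congr (#|` _|); apply/fsetP => y.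
rewrite mem_translate /symdiff !inE !mem_translate.
have -> : ((x^-1 * y)%g \in set_product [fset k] T0) =
    (((x * k)^-1 * y)%g \in T0).
  rewrite invgM -mulgA; apply/imfset2P/idP => [[k' + [t tT ->]]|kT].
    by rewrite inE => /eqP ->; rewrite mulKg.
  by exists k; rewrite ?inE //; exists (k^-1 * (x^-1 * y))%g => //; rewrite mulVKg.
by [].
Qed.

(** The expected number of uncovered points is at most the number of points
    near the boundary of Q plus |Q| times the separation probabilities.  The
    inequality is multiplied by |T0| and by the number of orders, so as to stay
    in the natural numbers. *)
Lemma sum_uncovered :
  (#|` T0| * (\sum_p uncovered p) <= #|{perm W}| *
    (#|` T0| * (\sum_(k <- exit_set) escape Q k) +
     #|` Q| * (\sum_(k <- K) #|` symdiff T0 (set_product [fset k] T0)|)))%N.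
Proof.
have unc p : (uncovered p <= \sum_(k <- exit_set) escape Q k +
    \sum_(k <- K) \sum_(x <- Q) ((x * k)%g \in Q) && split_at p x k)%N.
  rewrite exchange_big /= /uncovered -sum1_count big_mkcond /=.
  have -> : (\sum_(k <- exit_set) escape Q k =
      \sum_(x <- Q) \sum_(k <- exit_set) ((x * k)%g \notin Q))%N.
    rewrite exchange_big /=; apply: eq_bigr => k _.
    by rewrite /escape -sum1_count big_mkcond; apply: eq_bigr => x _; case: ifP.
  rewrite -big_split /= big_seq [leqRHS]big_seq; apply: leq_sum => x xQ.
  case: ifPn => // /hasPn xd.
  case: (split_or_exit xQ xd) => [[k kK kQ]|[k kK [kQ sp]]].
    by rewrite (big_rem k) //= kQ.
  by rewrite addnC (big_rem k) //= kQ sp.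
apply: (@leq_trans (#|` T0| * \sum_p (\sum_(k <- exit_set) escape Q k +
    \sum_(k <- K) \sum_(x <- Q) ((x * k)%g \in Q) && split_at p x k))).
  by rewrite leq_mul2l leq_sum ?orbT.
rewrite big_split /= sum_nat_const mulnDr mulnCA mulnDr leq_add2l.
rewrite exchange_big /= mulnA -[leqLHS]mulnC big_distrl big_distrr /=.
apply: leq_sum => k _; rewrite exchange_big /= big_distrl /=.
have -> : (#|{perm W}| * #|` Q| * #|` symdiff T0 (set_product [fset k] T0)| =
   \sum_(x <- Q) #|` symdiff T0 (set_product [fset k] T0)| * #|{perm W}|)%N.
  by rewrite big_const_seq count_predT iter_addn_0 [LHS]mulnC mulnA.
rewrite big_seq [leqRHS]big_seq; apply: leq_sum => x xQ.
case: (boolP ((x * k)%g \in Q)) => xkQ; last by rewrite big1.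
rewrite -(card_symdiff_translate x k) mulnC.
pose U := translate x T0 `|` translate (x * k)%g T0.
apply: (@leq_trans (#|` U| * #|[pred p | split_at p x k]|)).
  apply: leq_mul.
    by rewrite -(card_translate x T0) fsubset_leq_card ?fsubsetUl.
  by rewrite -sum1_card [leqRHS]big_mkcond; apply: leq_sum => p _; rewrite inE; case: split_at.
apply: card_has_min_in.
  apply/fsubsetP => y; rewrite /symdiff !inE => /orP[] /andP[? ->] //.
  by rewrite orbT.
apply/fsubsetP => y; rewrite inE !mem_translate => /orP[] yT.
  by have := QW xQ yT; rewrite mulVKg.
by have := QW xkQ yT; rewrite mulVKg.
Qed.

End Boundary.
End RandomPartition.

(** * Eigenvalue counting on partitions *)

Section WordBalls.
Variables (G : groupType) (S : {fset G}).
Hypothesis S_gen : generates S.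
Implicit Types (g h x y z : G) (F : {fset G}).
Local Open Scope fset_scope.

Lemma is_word_metric g h : is_word S (word_metric S g h) (g^-1 * h)%g.
Proof.
rewrite /word_metric /nat_inf; case: pselect => [ex|nex].
  by rewrite /=; case: ex_minnP => n /asboolP.
by case: (S_gen (g^-1 * h)%g) => L wL; case: nex; exists L; apply/asboolP.
Qed.

Lemma word_metricM x g h : word_metric S (x * g)%g (x * h)%g = word_metric S g h.
Proof. by rewrite /word_metric invgM -mulgA mulKg. Qed.

Fixpoint words n : {fset G} :=
  if n is m.+1 then set_product S (words m) else [fset 1%g].

Lemma mem_words n g : is_word S n g -> g \in words n.
Proof.
elim: n g => [|n IH] g [w wS <-].
  by rewrite tuple0 big_nil /= inE.
case/tupleP: w wS => s w wS; rewrite big_cons /=; apply/imfset2P.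
exists s; first by apply: wS; rewrite inE eqxx.
eexists; last by [].
by apply: IH; exists w => // x xw; apply: wS; rewrite inE xw orbT.
Qed.

(** Balls are left translates of one finite set K, so that interiors with
    respect to balls take the form [deep K]. *)
Lemma word_ball_fset n : exists K : {fset G},
  forall x y, word_ball S n x y <-> (x^-1 * y)%g \in K.
Proof.
pose B : set G := word_ball S n 1%g.
have finB : finite_set B.
  pose U : {fset G} := \bigcup_(i <- iota 0 n) words i.
  apply: (@sub_finite_set _ _ [set` U]); last exact: finite_fset.
  move=> g gn; apply/bigfcupP; eexists.
    by rewrite mem_iota andbT; exact: gn.
  by have := is_word_metric 1%g g; rewrite invg1 mul1g; exact: mem_words.
exists (fset_set B) => x y; rewrite in_fset_set // inE /B /word_ball /=.
by rewrite -(word_metricM x 1%g) mulg1 mulVKg.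
Qed.

Lemma shrink_deep r (K F : {fset G}) :
  (forall x y, word_ball S r.+1 x y <-> (x^-1 * y)%g \in K) ->
  shrink S r F = deep K F.
Proof.
move=> KP; apply/fsetP => x; rewrite !inE; apply: andb_id2l => _.
apply/asboolP/allP => [h k kK|h y /KP yK]; last first.
  by have := h _ yK; rewrite mulVKg.
by apply: h; apply/KP; rewrite mulKg.
Qed.

Lemma shrinkP r F x : reflect
  (x \in F /\ forall y, word_ball S r.+1 x y -> y \in F) (x \in shrink S r F).
Proof. by rewrite !inE; apply: (iffP andP) => -[h1 /asboolP h2]. Qed.

Lemma shrink_translate r g F : shrink S r (translate g F) = translate g (shrink S r F).
Proof.
apply/fsetP => x; rewrite mem_translate; apply/shrinkP/shrinkP.
  move=> [xF xb]; rewrite mem_translate in xF; split => // y yb.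
  have := xb (g * y)%g; rewrite mem_translate mulKg; apply.
  by rewrite /word_ball /= -(word_metricM g^-1) mulKg.
move=> [xF xb]; rewrite mem_translate; split => // y yb.
rewrite mem_translate; apply: xb.
by rewrite /word_ball /= word_metricM.
Qed.

End WordBalls.

Section PartitionCount.
Variables (G : groupType) (S : {fset G}) (R : realType).
Variable H : {linear ell2 G R -> ell2 G R}.
Local Open Scope fset_scope.
Hypothesis S_gen : generates S.
Hypothesis H_sa : self_adjoint H.
Variables (A : finType) (C : G -> A) (M N : nat).
Hypothesis H_hop : hopping_range S H M.
Hypothesis H_inv : invariance_range S H C N.
Let r := maxn M N.

Definition shrunk_count E (Q : {fset G}) : nat :=
  eigenvalue_count H (shrink S r Q) E.

(** A point outside F is at distance greater than the hopping range from the
    interior of F; in particular the interiors of disjoint sets do not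
    interact. *)
Lemma shrink_decoupled (F : {fset G}) x y :
  x \in shrink S r F -> y \notin F -> matrix_element H x y = 0.
Proof.
move=> /shrinkP[_ xF] yF; apply: H_hop; rewrite leqNgt; apply: contra yF => lt.
apply: xF; rewrite /word_ball /= ltnS.
by rewrite (leq_trans (ltnW lt)) ?leq_maxl.
Qed.

(** The matrix elements between interior points of Q are determined by the
    coloring on Q, so left translation intertwines the two compressions. *)
Lemma shrunk_count_local E g (Q : {fset G}) :
  (forall s, s \in Q -> C (g * s)%g = C s) ->
  shrunk_count E (translate g Q) = shrunk_count E Q.
Proof.
move=> gQ; rewrite /shrunk_count shrink_translate.
have := @eigenvalue_count_embed G R H H_sa (shrink S r Q)
  (translate g (shrink S r Q)) (fun x => (g * x)%g) E.
rewrite card_translate leq_add2r => h; apply/eqP; rewrite eqn_leq andbC.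
apply/andP; apply: h.
- by move=> x y _ _; exact: mulgI.
- by move=> x xQ; rewrite mem_translate mulKg.
- move=> x y /shrinkP[xQ xb] /shrinkP[yQ yb]; apply: H_inv => z zb.
  apply: gQ; have Nr : (N < r.+1)%N by rewrite ltnS leq_maxr.
  by case: zb => zb; [apply: xb|apply: yb]; exact: ltn_trans zb Nr.
Qed.

Lemma shrunk_count_le_card E Q : (shrunk_count E Q <= #|` Q|)%N.
Proof.
rewrite (leq_trans (eigenvalue_count_le_card H_sa _ _)) // fsubset_leq_card //.
by apply/fsubsetP => x /shrinkP[].
Qed.

Variable K : {fset G}.
Hypothesis KP : forall x y, word_ball S r.+1 x y <-> (x^-1 * y)%g \in K.
Variables (W T0 Q : {fset G}).
Hypothesis T0_1 : 1%g \in T0.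
Hypothesis QW : forall x t, x \in Q -> t \in T0 -> (x * t)%g \in W.

Let centers := deep (set_inverse T0) Q.

Lemma piece_sub (p : {perm W}) g : g \in centers -> piece T0 p g `<=` Q.
Proof.
move=> /deepP[_ gQ]; apply/fsubsetP => x /pieceP[xg _].
have := gQ (g^-1 * x)%g; rewrite mulVKg; apply.
by rewrite mem_set_inverse invgM invgK.
Qed.

(** The interiors of the pieces do not interact, so their counts add up; the
    rest of the interior of Q consists of uncovered points, each of which
    contributes at most one eigenvalue. *)
Lemma shrunk_count_pieces E (p : {perm W}) :
  (\sum_(g <- centers) shrunk_count E (piece T0 p g) <= shrunk_count E Q <=
   \sum_(g <- centers) shrunk_count E (piece T0 p g) + uncovered T0 Q K p)%N.
Proof.
have uniq_piece g g' x : g \in centers ->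
    x \in piece T0 p g -> x \in piece T0 p g' -> g = g'.
  move=> gc xg; apply: (piece_inj _ xg) => t; apply: QW.
  by have /fsubsetP := piece_sub p gc; apply.
have shrink_sub (F : {fset G}) x : x \in shrink S r F -> x \in F.
  by move=> /shrinkP[].
pose L := \bigcup_(g <- centers) shrink S r (piece T0 p g).
have LQ : L `<=` shrink S r Q.
  apply/fsubsetP => x /bigfcupP[g /andP[gc _]] /shrinkP[xg xb].
  have /fsubsetP gQ := piece_sub p gc.
  by apply/shrinkP; split => [|y /xb]; exact: gQ.
have Lcount : eigenvalue_count H L E =
    (\sum_(g <- centers) shrunk_count E (piece T0 p g))%N.
  apply: eigenvalue_count_bigcup => //.
  - move=> g g' gc _ gg'; apply/fdisjointP => x /shrink_sub xg.
    apply/negP => /shrink_sub xg'; case/eqP: gg'; exact: uniq_piece xg xg'.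
  - move=> g g' _ g'c gg' x y xg /shrink_sub yg'.
    apply: (shrink_decoupled xg); apply: contra gg' => yg.
    by apply/eqP/esym; exact: uniq_piece yg' yg.
have [] := eigenvalue_count_subset H_sa E LQ.
rewrite Lcount => h1 h2; rewrite h1 /=.
rewrite -(leq_add2r #|` L|) (leq_trans h2) // -addnA leq_add2l.
rewrite -(cardfsID L (shrink S r Q)) addnC leq_add //; last first.
  by rewrite fsubset_leq_card // fsubsetIr.
rewrite -count_predT; apply: (@count_inj _ _ _ _ _ id) => // x.
rewrite inE => /andP[xL /shrink_sub ->] _ /=; apply: contra xL => /hasP[g gc].
move=> xg; apply/bigfcupP; exists g; first by rewrite gc.
by rewrite (shrink_deep _ KP).
Qed.

Lemma shrunk_count_average E :
  (\sum_(g <- centers) \sum_(p : {perm W}) shrunk_count E (piece T0 p g) <=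
    #|{perm W}| * shrunk_count E Q <=
   \sum_(g <- centers) \sum_(p : {perm W}) shrunk_count E (piece T0 p g) +
   \sum_(p : {perm W}) uncovered T0 Q K p)%N.
Proof.
rewrite exchange_big /= -big_split /= -sum_nat_const.
by apply/andP; split; apply: leq_sum => p _; case/andP: (shrunk_count_pieces E p).
Qed.

End PartitionCount.

(** * Folner sequences and tempered repetitivity *)

Lemma uniform_cauchy_limit (R : realType) (X : Type) (e : nat -> X -> R) :
  (forall eps, 0 < eps -> exists m0, forall m m', (m0 <= m)%N -> (m0 <= m')%N ->
    forall x, `|e m x - e m' x| <= eps) ->
  exists l : X -> R, forall eps, 0 < eps ->
    \forall m \near \oo, forall x, `|l x - e m x| <= eps.
Proof.
move=> ec.
have cv x : cvg ((e ^~ x) @ \oo).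
  apply/cauchy_cvgP; apply: cauchy_exP => eps e0.
  have e2 : 0 < eps / 2 by rewrite divr_gt0.
  have [m0 h] := ec _ e2; exists (e m0 x); exists m0 => // m /= m0m.
  rewrite /ball /= ; apply: (le_lt_trans (h _ _ (leqnn _) m0m x)).
  by rewrite ltr_pdivrMr // ltr_pMr // ltr1n.
exists (fun x => lim (e ^~ x @ \oo)) => eps e0.
have [m0 h] := ec _ e0; exists m0 => // m /= m0m x /=.
have lo : e m x - eps <= lim (e ^~ x @ \oo).
  apply: limr_ge; first exact: cv.
  exists m0 => // m' /= m0m'; have := h _ _ m0m m0m' x.
  by rewrite ler_norml => /andP[]; lra.
have hi : lim (e ^~ x @ \oo) <= e m x + eps.
  apply: limr_le; first exact: cv.
  exists m0 => // m' /= m0m'; have := h _ _ m0m m0m' x.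
  by rewrite ler_norml => /andP[]; lra.
by rewrite ler_norml; apply/andP; split; lra.
Qed.

Section FolnerSequence.
Variables (R : realType) (G : groupType) (T : nat -> {fset G}).
Hypothesis T_folner : strong_folner_exhaustion R T.
Local Open Scope fset_scope.
Local Open Scope ring_scope.

Lemma near_symdiff_folner k eps : 0 < eps -> \forall m \near \oo,
  (#|` symdiff (T m) (set_product [fset k] (T m))|%:R : R) <= eps * #|` T m|%:R.
Proof.
move=> e0; have k0 : [fset k] != fset0 by apply/fset0Pn; exists k; rewrite inE.
have /cvgr0Pnorm_le/(_ _ e0) := sfe_folner T_folner k0; apply: filterS => m.
have Tm : (0 : R) < #|` T m|%:R.
  by rewrite ltr0n cardfs_gt0; apply/fset0Pn; exists 1%g; exact: sfe_id T_folner _.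
by rewrite ger0_norm ?divr_ge0 // ler_pdivrMr.
Qed.

Lemma near_escape_folner k eps : 0 < eps -> \forall m \near \oo,
  ((escape (set_inverse (T m)) k)%:R : R) <= eps * #|` set_inverse (T m)|%:R.
Proof.
move=> e0; have := near_symdiff_folner k e0; apply: filterS => m.
rewrite card_set_inverse; apply: le_trans.
by rewrite ler_nat escape_set_inverse_le.
Qed.

Lemma card_set_inverse_gt0 m : (0 < #|` set_inverse (T m)|)%N.
Proof.
rewrite card_set_inverse cardfs_gt0; apply/fset0Pn; exists 1%g.
exact: sfe_id T_folner _.
Qed.

Lemma set_inverse_mono m n : (n <= m)%N -> set_inverse (T n) `<=` set_inverse (T m).
Proof.
move=> nm; apply/fsubsetP => x; rewrite !mem_set_inverse; apply/fsubsetP.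
elim: m nm => [|m IH]; first by rewrite leqn0 => /eqP ->.
rewrite leq_eqVlt => /predU1P[->//|/IH h].
exact: fsubset_trans h (sfe_increasing T_folner m).
Qed.

End FolnerSequence.

(** A pattern is a class of supports, and the same finite set can be written
    as a translate in several ways; the copy of the patch at g0 is therefore
    recovered through the composite of the two translations that relate the
    representatives, not through their base points. *)
Lemma tempered_repetitive_sequence (R : realType) (G : groupType) (A : finType)
    (C : G -> A) (T : nat -> {fset G}) : tempered_repetitive C T R ->
  exists2 c : R, 0 < c & repetitive_sequence C (fun m => set_inverse (T m)) c.
Proof.
rewrite /tempered_repetitive; set B := (X in inf X) => B0; exists (inf B) => // m.
have lbB : has_lbound B.
  by exists 0 => _ [k _ <-]; case: repetitivity => // n; rewrite divr_ge0.
have /(ge_inf lbB) : B (if repetitivity C T m is Some n then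
    #|` T m|%:R / #|` T n|%:R else 0) by exists m.
case e : (repetitivity C T m) => [n|] infm; last first.
  by have := lt_le_trans B0 infm; rewrite ltxx.
move: e; rewrite /repetitivity /nat_inf; case: pselect => // ex [].
case: ex_minnP => n' /asboolP rep _ e; rewrite {}e in rep.
exists n.
  rewrite !card_set_inverse; have [Tn0|Tn] := posnP #|` T n|.
    by rewrite Tn0 mulr0.
  by rewrite -ler_pdivlMr // ltr0n.
move=> g0 g.
have [|x [h [[k kx kC] /fsubsetP sub hC]]] := rep (pattern C (translate g0 (set_inverse (T m)))) _ g.
  by exists g0.
have kxE s : s \in set_inverse (T m) -> exists2 s', s' \in set_inverse (T m) &
    (k * (g0 * s) = x * s')%g.
  move=> sF; have : (k * (g0 * s))%g \in translate x (set_inverse (T m)).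
    by rewrite -kx !mem_translate !mulKg.
  by rewrite mem_translate => ?; exists (x^-1 * (k * (g0 * s)))%g; rewrite ?mulVKg.
exists (h * (k * g0))%g => s sF; have [s' s'F e] := kxE s sF.
  have := sub (h * (x * s'))%g; rewrite !mem_translate !mulKg => /(_ s'F).
  by rewrite -e !mulgA.
have -> : (h * (k * g0) * s = h * x * s')%g by rewrite -!mulgA e.
rewrite hC // -e; apply: kC.
by rewrite mem_translate mulKg.
Qed.

(** * Averages of functions of finite patterns *)

Section PatternAverages.
Variables (R : realType) (G : groupType) (F : nat -> {fset G}).
Local Open Scope fset_scope.
Local Open Scope ring_scope.
Hypothesis F_gt0 : forall m, (0 < #|` F m|)%N.
Hypothesis F_mono : forall m n, (n <= m)%N -> F n `<=` F m.
Hypothesis F_folner : forall k (eps : R), 0 < eps ->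
  \forall m \near \oo, (escape (F m) k)%:R <= eps * #|` F m|%:R.
Variables (A : finType) (C : G -> A) (c : R).
Hypothesis c_gt0 : 0 < c.
Hypothesis F_rep : repetitive_sequence C F c.
Variable T0 : {fset G}.
Let F0 := set_inverse T0.

Definition color_pattern (g : G) : {ffun F0 -> A} :=
  [ffun y => C (g * val y)%g].

Lemma color_patternP g h : reflect
  (forall x, x \in F0 -> C (g * x)%g = C (h * x)%g)
  (color_pattern g == color_pattern h).
Proof.
apply: (iffP eqP) => [/ffunP gh x xF|gh].
  by have := gh [` xF]; rewrite !ffunE.
by apply/ffunP => y; rewrite !ffunE gh //; exact: valP.
Qed.

Lemma deep_sum_dist (m : nat) (f : G -> R) :
  (forall x, 0 <= f x <= 1) ->
  `|\sum_(x <- F m) f x - \sum_(x <- deep F0 (F m)) f x| <=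
    \sum_(z <- F0) (escape (F m) z)%:R.
Proof.
move=> f01; rewrite (sum_fsubset _ (deep_sub F0 (F m))) addrC addKr.
rewrite ger0_norm; last by apply: sumr_ge0 => x _; case/andP: (f01 x).
apply: (@le_trans _ _ (\sum_(x <- F m `\` deep F0 (F m)) 1)).
  by apply: ler_sum => x _; case/andP: (f01 x).
rewrite big_const_seq count_predT iter_addr addr0 -natr_sum ler_nat.
exact: card_setD_deep.
Qed.

(** A function of the pattern around g takes one value v q for each of the
    finitely many patterns q, so its averages are combinations of pattern
    frequencies.  Only the bound B on phi enters the choice of m0: phi may depend
    on m, m' and on the energy, which is why the conclusion compares two indices
    with a common V instead of asserting a limit. *)
Lemma pattern_average (B eps : R) : 0 <= B -> 0 < eps ->
  exists m0, forall m m', (m0 <= m)%N -> (m0 <= m')%N ->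
  forall phi : G -> R, (forall g, 0 <= phi g <= B) ->
  {in [predU deep F0 (F m) & deep F0 (F m')] &,
    forall g h, (forall x, x \in F0 -> C (g * x)%g = C (h * x)%g) ->
    phi g = phi h} ->
  exists V, forall i, i = m \/ i = m' ->
    `|\sum_(g <- deep F0 (F i)) phi g - V * #|` F i|%:R| <=
      eps * #|` F i|%:R.
Proof.
move=> B0 e0; pose P := {ffun F0 -> A}.
pose f (q : P) g : R := (color_pattern g == q)%:R.
have f01 q x : 0 <= f q x <= 1 by rewrite /f ler0n lern1 leq_b1.
have f_local q (g h : G) :
    (forall x, x \in F0 -> C (g * x)%g = C (h * x)%g) -> f q g = f q h.
  by move=> /color_patternP/eqP; rewrite /f => ->.
have freq q : exists Mq, forall d, 0 < d -> \forall m \near \oo,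
    `|\sum_(x <- F m) f q x - Mq * #|` F m|%:R| <= d * #|` F m|%:R.
  exact: (local_average_cvg F_gt0 F_mono F_folner c_gt0 F_rep (f01 q) (@f_local q)).
have [Mq MqP] := choice freq.
(* Each pattern contributes an error 2 d B |F_i|; the successors only avoid
     a division by zero. *)
pose d := eps / (2 * (B + 1) * (#|P|.+1)%:R).
have D0 : 0 < 2 * (B + 1) * (#|P|.+1)%:R.
  by rewrite !mulr_gt0 // ltr_wpDl.
have d0 : 0 < d by rewrite divr_gt0.
have dE : eps = d * (2 * (B + 1) * (#|P|.+1)%:R).
  by rewrite /d divfK // gt_eqF.
clearbody d.
have [m1 _ h1] := near_sum_escape F_folner F0 d0.
have [m2 _ h2] := near_all (enum P) (fun q => MqP q d d0).
exists (maxn m1 m2) => m m' mm mm' phi phiB phiC.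
pose X := [predU deep F0 (F m) & deep F0 (F m')].
have [v vP] : exists v : P -> R, (forall q, 0 <= v q <= B) /\
    forall g, g \in X -> v (color_pattern g) = phi g.
  pose v q := if pselect (exists2 g, g \in X & color_pattern g = q) is left ex
    then phi (s2val (cid2 ex)) else 0.
  exists v; split => [q|g gX].
    by rewrite /v; case: pselect => // _; rewrite lexx B0.
  rewrite /v; case: pselect => [ex|nex]; last by case: nex; exists g.
  case: cid2 => h hX hg /=; apply: phiC => //.
  by apply/color_patternP; rewrite hg.
exists (\sum_q v q * Mq q) => i im.
have [im1 im2] : (m1 <= i)%N /\ (m2 <= i)%N.
  by move: mm mm'; rewrite !geq_max => /andP[? ?] /andP[? ?]; case: im => ->.
have sub : {subset deep F0 (F i) <= X}.
  by move=> g gi; rewrite inE; case: im gi => -> ->; rewrite ?orbT.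
have -> : \sum_(g <- deep F0 (F i)) phi g =
    \sum_q v q * \sum_(g <- deep F0 (F i)) f q g.
  under [RHS]eq_bigr do rewrite mulr_sumr.
  rewrite exchange_big /= big_seq [RHS]big_seq; apply: eq_bigr => g /sub gX.
  rewrite (bigD1 (color_pattern g)) //= big1 => [|q].
    by rewrite addr0 /f eqxx mulr1 vP.2.
  by rewrite /f eq_sym => /negbTE ->; rewrite mulr0.
rewrite mulr_suml -sumrB; apply: (le_trans (ler_norm_sum _ _ _)).
apply: (@le_trans _ _ (\sum_(q : P) B * (2 * d * #|` F i|%:R))).
  apply: ler_sum => q _; rewrite -[v q * Mq q * _]mulrA -mulrBr normrM.
  have /andP[v0 vB] := vP.1 q; rewrite ger0_norm //.
  apply: ler_pM => //.
  have := h2 i im2 q; rewrite mem_enum => /(_ isT).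
  have := le_trans (deep_sum_dist i (f01 q)) (h1 i im1).
  rewrite !ler_norml => /andP[? ?] /andP[? ?]; apply/andP; split; lra.
have -> : \sum_(q : P) B * (2 * d * #|` F i|%:R) =
    #|P|%:R * (B * (2 * d * #|` F i|%:R)) by rewrite sumr_const; exact/esym/mulr_natl.
have nE : (#|P|.+1)%:R = #|P|%:R + 1 :> R by rewrite natr1.
rewrite nE in dE; have n0 : (0 : R) <= #|P|%:R by [].
have dF : 0 <= d * #|` F i|%:R by rewrite mulr_ge0 // ltW.
rewrite dE -subr_ge0.
move: n0 dF; move: (#|P|%:R : R) (#|` F i|%:R : R) => n a n0 dF.
rewrite (_ : _ - _ = 2 * (d * a) * (B + n + 1)); last by ring.
apply: mulr_ge0; first by rewrite mulr_ge0.
by rewrite addr_ge0 // addr_ge0.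
Qed.

End PatternAverages.

(** * Uniform convergence of the empirical distributions *)

Section EmpiricalDistributions.
Variables (R : realType) (G : groupType) (S : {fset G}).
Hypothesis S_gen : generates S.
Variable T : nat -> {fset G}.
Hypothesis T_folner : strong_folner_exhaustion R T.
Variable H : {linear ell2 G R -> ell2 G R}.
Hypothesis H_sa : self_adjoint H.
Local Open Scope fset_scope.
Local Open Scope ring_scope.
Let F m := set_inverse (T m).

(** For given m and m' the random order is put on one set W that serves both
    F_m and F_m', so that the same function phi describes both counts. *)
Lemma empirical_cauchy (A : finType) (C : G -> A) (M N : nat) :
  tempered_repetitive C T R ->
  hopping_range S H M -> invariance_range S H C N ->
  forall eps, 0 < eps -> exists m0, forall m m', (m0 <= m)%N -> (m0 <= m')%N ->
    forall E, `|empirical_distribution S H T (maxn M N) m E -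
                empirical_distribution S H T (maxn M N) m' E| <= eps.
Proof.
move=> C_temp H_hop H_inv eps e0.
have [c c0 F_rep] := tempered_repetitive_sequence C_temp.
have [K KP] := word_ball_fset S_gen (maxn M N).+1.
have e8 : 0 < eps / 8 by rewrite divr_gt0.
have [j TjK] : exists j, \sum_(k <- K)
    (#|` symdiff (T j) (set_product [fset k] (T j))|%:R : R) <=
    eps / 8 * #|` T j|%:R.
  have [j _ h] := near_sum_le (u := fun k m =>
      #|` symdiff (T m) (set_product [fset k] (T m))|%:R : R) K
    (fun m => ler0n R #|` T m|) (near_symdiff_folner T_folner) e8.
  by exists j; apply: h => /=.
pose T0 := T j; pose X := exit_set T0 K.
(* The tile T0 is fixed before m grows, so the exit set X is a fixed finite set. *)
have [m1 _ esc] := near_sum_escape (near_escape_folner T_folner) X e8.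
pose B : R := #|` set_inverse T0|%:R.
have [m2 avg] := pattern_average (card_set_inverse_gt0 T_folner)
  (set_inverse_mono T_folner) (near_escape_folner T_folner) c0 F_rep
  T0 (ler0n R _ : 0 <= B) e8.
exists (maxn m1 m2) => m m' mm mm' E.
pose W := set_product (F m `|` F m') T0.
pose N0 : R := #|{perm W}|%:R.
have N0_gt0 : 0 < N0 by rewrite ltr0n; apply/card_gt0P; exists 1%g.
have T0_1 : 1%g \in T0 by exact: sfe_id T_folner _.
have T0_gt0 : (0 : R) < #|` T0|%:R.
  by rewrite ltr0n cardfs_gt0; apply/fset0Pn; exists 1%g.
have FW i : i = m \/ i = m' -> forall x t, x \in F i -> t \in T0 -> (x * t)%g \in W.
  move=> im x t xF tT; apply/imfset2P; exists x; last by exists t.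
  by case: im xF => -> xF; rewrite inE xF ?orbT.
pose b := shrunk_count S H M N E.
pose phi g : R := (\sum_(p : {perm W}) b (piece T0 p g))%N%:R / N0.
have phiB g : 0 <= phi g <= B.
  rewrite /phi divr_ge0 ?(ltW N0_gt0) //= ler_pdivrMr // /N0 -natrM ler_nat mulnC -sum_nat_const.
  apply: leq_sum => p _; rewrite (leq_trans (shrunk_count_le_card _ H_sa _ _ _ _)) //.
  rewrite -(card_translate g (set_inverse T0)) fsubset_leq_card //.
  by apply/fsubsetP => x; rewrite inE => /andP[].
have phiC : {in [predU deep (set_inverse T0) (F m) & deep (set_inverse T0) (F m')] &,
    forall g h, (forall x, x \in set_inverse T0 -> C (g * x)%g = C (h * x)%g) ->
    phi g = phi h}.
  have lab g : g \in [predU deep (set_inverse T0) (F m) & deep (set_inverse T0) (F m')] ->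
      labelled_around W T0 g.
    rewrite inE => gX x t xF tT; rewrite mulgA.
    case/orP: gX => /deepP[_ gF].
      by apply: (FW m (or_introl erefl)) => //; exact: gF.
    by apply: (FW m' (or_intror erefl)) => //; exact: gF.
  move=> g h /lab gW /lab hW gh.
  have bl := shrunk_count_local H_sa M H_inv E.
  exact: (congr1 (fun n : nat => n%:R / N0) (sum_piece_pattern T0_1 bl gW hW gh)).
have [V VP] : exists V, forall i, i = m \/ i = m' ->
    `|\sum_(g <- deep (set_inverse T0) (F i)) phi g - V * #|` F i|%:R| <=
      eps / 8 * #|` F i|%:R.
  move: mm mm'; rewrite !geq_max => /andP[_ mm] /andP[_ mm'].
  exact: avg mm mm' _ phiB phiC.
have near_V i : i = m \/ i = m' ->
    `|empirical_distribution S H T (maxn M N) i E - V| <= eps / 2.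
  move=> im.
  have Fi : (0 : R) < #|` F i|%:R by rewrite ltr0n (card_set_inverse_gt0 T_folner).
  rewrite /empirical_distribution -[eigenvalue_count _ _ _]/(b (F i)).
  have -> : (b (F i))%:R / #|` set_inverse (T i)|%:R - V =
      ((b (F i))%:R - V * #|` F i|%:R) / #|` F i|%:R.
    by rewrite mulrBl mulfK // gt_eqF.
  rewrite normrM normfV (gtr0_norm Fi) ler_pdivrMr //.
  have QW := FW i im.
  have /andP[lo hi] := shrunk_count_average H_sa H_hop KP QW E.
  have unc := sum_uncovered T0_1 K QW.
  have sumphi : N0 * \sum_(g <- deep (set_inverse T0) (F i)) phi g =
      (\sum_(g <- deep (set_inverse T0) (F i))
         \sum_(p : {perm W}) b (piece T0 p g))%N%:R.
    rewrite natr_sum mulr_sumr; apply: eq_bigr => g _.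
    by rewrite /phi mulrC divfK // gt_eqF.
  have lo' : \sum_(g <- deep (set_inverse T0) (F i)) phi g <= (b (F i))%:R.
    by rewrite -(ler_pM2l N0_gt0) sumphi -natrM ler_nat.
  have U : (\sum_(p : {perm W}) uncovered T0 (F i) K p)%N%:R <=
      N0 * (eps / 4 * #|` F i|%:R) :> R.
    rewrite -(ler_pM2l T0_gt0) -natrM.
    apply: (@le_trans _ _ (N0 * (#|` T0|%:R * (eps / 8 * #|` F i|%:R) +
        #|` F i|%:R * (eps / 8 * #|` T0|%:R)))).
      move: unc; rewrite -(ler_nat R) => /le_trans; apply.
      rewrite natrM natrD !natrM !natr_sum ler_pM2l //.
      apply: lerD; rewrite ler_pM2l //.
      apply: esc; move: im mm mm'; rewrite /= !geq_max.
      by case=> -> /andP[? _] /andP[? _].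
    lra.
  have hi' : (b (F i))%:R <= \sum_(g <- deep (set_inverse T0) (F i)) phi g +
      eps / 4 * #|` F i|%:R.
    rewrite -(ler_pM2l N0_gt0) mulrDr sumphi -natrM.
    apply: le_trans (lerD (lexx _) U); rewrite -natrD ler_nat.
    exact: hi.
  have := VP i im; rewrite !ler_norml => /andP[? ?].
  have : 0 < eps * #|` F i|%:R by rewrite mulr_gt0.
  by move=> ?; apply/andP; split; lra.
have := near_V m (or_introl erefl); have := near_V m' (or_intror erefl).
by rewrite !ler_norml => /andP[? ?] /andP[? ?]; apply/andP; split; lra.
Qed.

(** Both compressions contain the one for the larger range, and what is left
    lies near the boundary of F_m. *)
Lemma near_empirical_range (r r' : nat) eps : 0 < eps -> \forall m \near \oo,
  forall E, `|empirical_distribution S H T r m E -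
              empirical_distribution S H T r' m E| <= eps.
Proof.
move=> e0; have [K KP] := word_ball_fset S_gen (maxn r r').+1.
have := near_sum_escape (near_escape_folner T_folner) K e0.
apply: filterS => m esc E.
have Fm : (0 : R) < #|` F m|%:R by rewrite ltr0n (card_set_inverse_gt0 T_folner).
rewrite /empirical_distribution -/(F m) -mulrBl normrM normfV (gtr0_norm Fm).
rewrite ler_pdivrMr //.
pose L := shrink S (maxn r r') (F m).
have LF : (#|` F m| <= #|` L| + \sum_(k <- K) escape (F m) k)%N.
  rewrite -(cardfsID L (F m)) /L (shrink_deep _ KP).
  by rewrite leq_add ?card_setD_deep // fsubset_leq_card ?fsubsetIr.
have range q : (q <= maxn r r')%N ->
    (eigenvalue_count H L E <= eigenvalue_count H (shrink S q (F m)) E <=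
     eigenvalue_count H L E + \sum_(k <- K) escape (F m) k)%N.
  move=> qr; have sub : L `<=` shrink S q (F m).
    apply/fsubsetP => x /shrinkP[xF xb]; apply/shrinkP; split => // y yb.
    by apply: xb; exact: leq_trans yb _.
  have [-> h2] := eigenvalue_count_subset H_sa E sub.
  rewrite /= -(leq_add2r #|` L|) (leq_trans h2) // -addnA leq_add2l addnC.
  rewrite (leq_trans _ LF) //; apply: fsubset_leq_card.
  by apply/fsubsetP => x /shrinkP[].
have /andP[l1 u1] := range r (leq_maxl _ _).
have /andP[l2 u2] := range r' (leq_maxr _ _).
apply: le_trans esc; rewrite -natr_sum.
move: l1 u1 l2 u2; rewrite -!(ler_nat R) !natrD => l1 u1 l2 u2.
rewrite ler_norml; apply/andP; split; lra.
Qed.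

Lemma empirical_distribution01 r m E :
  0 <= empirical_distribution S H T r m E <= 1.
Proof.
have Fm : (0 : R) < #|` F m|%:R by rewrite ltr0n (card_set_inverse_gt0 T_folner).
rewrite divr_ge0 //= ler_pdivrMr // mul1r ler_nat.
rewrite (leq_trans (eigenvalue_count_le_card H_sa _ _)) //.
by apply: fsubset_leq_card; apply/fsubsetP => x /shrinkP[].
Qed.

End EmpiricalDistributions.

Lemma right_continuous_uniform_limit (R : realType) (e : nat -> R -> R) (l : R -> R) :
  (forall eps, 0 < eps -> \forall m \near \oo, forall x, `|l x - e m x| <= eps) ->
  (forall m x, \forall y \near x^'+, e m y = e m x) -> right_continuous l.
Proof.
move=> el econst x; apply/cvgrPdist_le => eps e0.
have e2 : 0 < eps / 2 by rewrite divr_gt0.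
have [m _ /(_ m (leqnn m)) h] := el _ e2.
apply: filterS (econst m x) => y exy.
have := h x; have := h y; rewrite exy !ler_norml.
by move=> /andP[? ?] /andP[? ?]; apply/andP; split; lra.
Qed.

Theorem corollary1p6 (R : realType) (G : groupType) (S : {fset G})
    (S_sym : symmetric_subset S) (S_gen : generates S)
    (G_amenable : amenable G R)
    (A : finType) (C : G -> A) (T : nat -> {fset G})
    (T_folner : strong_folner_exhaustion R T)
    (C_tempered : tempered_repetitive C T R)
    (H : {linear ell2 G R -> ell2 G R})
    (H_sa : self_adjoint H)
    (H_hop : finite_hopping_range S H)
    (H_inv : coloring_invariant S H C) :
  exists N_H : R -> R,
    [/\ forall E, 0 <= N_H E <= 1,
        right_continuous N_H &
        forall M N : nat, hopping_range S H M -> invariance_range S H C N ->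
          (fun m : nat => ereal_sup (range (fun E : R =>
             `|N_H E - empirical_distribution S H T (maxn M N) m E|%:E)))
            @ \oo --> 0%E].
Proof.
have [M0 hopM0] := H_hop; have [N0 invN0] := H_inv.
have [N_H N_HP] := uniform_cauchy_limit
  (empirical_cauchy S_gen T_folner H_sa C_tempered hopM0 invN0).
exists N_H; split.
- move=> E; apply/andP; split.
    rewrite leNgt; apply/negP => lt0.
    have e0 : 0 < - N_H E / 2 by rewrite divr_gt0 // oppr_gt0.
    have [m _ /(_ m (leqnn m) E)] := N_HP _ e0.
    have /andP[] := empirical_distribution01 S T_folner H_sa (maxn M0 N0) m E.
    by rewrite ler_norml => ? ? /andP[? ?]; lra.
  rewrite leNgt; apply/negP => gt1.
  have e0 : 0 < (N_H E - 1) / 2 by rewrite divr_gt0 // subr_gt0.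
  have [m _ /(_ m (leqnn m) E)] := N_HP _ e0.
  have /andP[] := empirical_distribution01 S T_folner H_sa (maxn M0 N0) m E.
  by rewrite ler_norml => ? ? /andP[? ?]; lra.
- apply: (right_continuous_uniform_limit N_HP) => m E.
  apply: filterS (eigenvalue_count_right H_sa (shrink S (maxn M0 N0) (set_inverse (T m))) E).
  by move=> E' ce; rewrite /empirical_distribution ce.
move=> M N _ _.
have near_sup eps : 0 < eps -> \forall m \near \oo,
    (0 <= ereal_sup (range (fun E : R =>
      `|N_H E - empirical_distribution S H T (maxn M N) m E|%:E)) <= eps%:E)%E.
  move=> e0; have e2 : 0 < eps / 2 by rewrite divr_gt0.
  have := near_empirical_range S_gen T_folner H_sa (maxn M0 N0) (maxn M N) e2.
  apply: filterS2 (N_HP _ e2) => m h1 h2; apply/andP; split.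
    apply: (@le_trans _ _ (`|N_H 0 - empirical_distribution S H T (maxn M N) m 0|%:E)).
      by rewrite lee_fin.
    by apply: ereal_sup_ubound; exists 0.
  apply: ge_ereal_sup => _ [E _ <-]; rewrite lee_fin.
  have := h1 E; have := h2 E; rewrite !ler_norml.
  by move=> /andP[? ?] /andP[? ?]; apply/andP; split; lra.
apply/fine_cvgP; split.
  apply: filterS (near_sup 1 ltr01) => m /andP[s0 s1].
  by rewrite ge0_fin_numE // (le_lt_trans s1) // ltry.
apply/cvgr0Pnorm_le => eps e0; apply: filterS (near_sup eps e0) => m /andP[s0 s1].
rewrite ger0_norm /= ?fine_ge0 //.
by rewrite -lee_fin fineK // ge0_fin_numE // (le_lt_trans s1) // ltry.
Qed.
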